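(* Let $\mathcal{P}\subset\mathbb{R}^s$ be a lattice polytope and let $w_1,\ldots,w_p:\mathbb{R}^s\to\mathbb{R}$ be linear weights with $w_i(\mathbb{Z}^s)\subset\mathbb{Z}$. If $\mathcal{P}$ has a $(w_1,\ldots,w_p)$-compatible triangulation, then the numerator of the rational form of the $q$-weighted Ehrhart series $F_{\mathcal{P}}^{q,w}(q,1,x)$ has positive coefficients (that is, all its nonzero coefficients are positive). Nevertheless, this is only a sufficient condition for positivity: there exist a lattice polytope and linear weights for which the numerator has positive coefficients although no compatible triangulation exists.
   Context: For a lattice polytope $\mathcal{P}\subset\mathbb{R}^s$ (convex hull of finitely many points of $\mathbb{Z}^s$), $\mathrm{cone}(\mathcal{P})\subset\mathbb{R}^{s+1}$ is the cone generated by $\{(x,1):x\in\mathcal{P}\cap\mathbb{Z}^s\}$, so that $(a,n)\in\mathrm{cone}(\mathcal{P})\cap\mathbb{Z}^{s+1}$ iff $n\in\mathbb{N}$ and $a\in n\mathcal{P}\cap\mathbb{Z}^s$. The $q$-weighted Ehrhart series is $F_{\mathcal{P}}^{q,w}(q,1,x)=\sum_{(a,n)\in\mathrm{cone}(\mathcal{P})\cap\mathbb{Z}^{s+1}}q_1^{w_1(a)}\cdots q_p^{w_p(a)}x^n$, a power series in $x$ with coefficients in $\mathbb{Z}[q_1^{\pm1},\ldots,q_p^{\pm1}]$; for linear weights it is a rational function. Its rational form is its expression $N(q,x)/D(q,x)$ in lowest terms with $N,D\in\mathbb{Z}[q_1^{\pm1},\ldots,q_p^{\pm1}][x]$, normalized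 so that $D(q,0)=1$; $N$ is the numerator. A triangulation $\mathcal{T}$ of $\mathcal{P}$ (into simplices with vertices in $\mathbb{Z}^s$) is $(w_1,\ldots,w_p)$-compatible if the multiset of weight vectors $\{(w_1(v),\ldots,w_p(v)):v\text{ a vertex of }\Delta\}$ is the same for every maximal simplex $\Delta\in\mathcal{T}$. *)

(* Defs.v *)
From HB Require Import structures.
From mathcomp Require Import all_boot all_order all_algebra finmap.
From mathcomp Require Import all_classical all_reals.

Set Implicit Arguments.
Unset Strict Implicit.
Unset Printing Implicit Defensive.

Import Order.TTheory GRing.Theory Num.Theory.

Local Open Scope ring_scope.

(* The ring Z[q_1^{+-1}, ..., q_p^{+-1}].  The monomial group algebras of
   the multinomials library do not apply: their monomials have no inverses. *)

Definition laurent (p : nat) := {fsfun 'rV[int]_p -> int with 0}.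

HB.instance Definition _ p := Choice.on (laurent p).

(* [lcoef f b] is the coefficient of q^b = q_1^{b_1} ... q_p^{b_p} in f. *)
Definition lcoef p (f : laurent p) (b : 'rV[int]_p) : int := f b.

Section LaurentRing.
Variable p : nat.
Implicit Types (f g h : laurent p) (a b k : 'rV[int]_p).

Definition lmonom b : laurent p := [fsfun k in [fset b]%fset => 1 | 0].

Definition lzero : laurent p := [fsfun].

Definition lone : laurent p := lmonom 0.

Definition lopp f : laurent p := [fsfun k in finsupp f => - f k | 0].

Definition ladd f g : laurent p :=
  [fsfun k in (finsupp f `|` finsupp g)%fset => f k + g k | 0].

Definition lmul f g : laurent p :=
  [fsfun k in [fset (a + b)%R | a in finsupp f, b in finsupp g]%fset =>
     \sum_(a <- finsupp f) f a * g (k - a) | 0].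

Lemma lmonomE b k : lmonom b k = (k == b)%:R.
Proof. by rewrite fsfunE inE; case: eqP. Qed.

Lemma lzeroE k : lzero k = 0.
Proof. by rewrite fsfunE. Qed.

Lemma loppE f k : lopp f k = - f k.
Proof. by rewrite fsfunE; case: (finsuppP f k); rewrite ?oppr0. Qed.

Lemma laddE f g k : ladd f g k = f k + g k.
Proof.
rewrite fsfunE in_fsetU; case: (finsuppP f k) => //=.
by case: (finsuppP g k); rewrite ?addr0.
Qed.

Lemma lmulE f g k : lmul f g k = \sum_(a <- finsupp f) f a * g (k - a).
Proof.
rewrite fsfunE; case: ifPn => // /imfset2P nk.
rewrite big_seq big1 // => a af; case: (finsuppP g (k - a)) => [|kag].
  by rewrite mulr0.
case: nk; exists a => //; exists (k - a) => //.
by rewrite addrC subrK.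
Qed.

Lemma lmulEw (S : {fset 'rV[int]_p}) f g k : (finsupp f `<=` S)%fset ->
  lmul f g k = \sum_(a <- S) f a * g (k - a).
Proof.
move=> fS; rewrite lmulE; apply: big_fset_incl => // a _ /fsfun_dflt ->.
by rewrite mul0r.
Qed.

Lemma laddA : associative ladd.
Proof. by move=> f g h; apply/fsfunP => k; rewrite !laddE addrA. Qed.

Lemma laddC : commutative ladd.
Proof. by move=> f g; apply/fsfunP => k; rewrite !laddE addrC. Qed.

Lemma ladd0 : left_id lzero ladd.
Proof. by move=> f; apply/fsfunP => k; rewrite laddE lzeroE add0r. Qed.

Lemma laddN : left_inverse lzero lopp ladd.
Proof. by move=> f; apply/fsfunP => k; rewrite laddE loppE lzeroE addNr. Qed.

Lemma lmulC : commutative lmul.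
Proof.
move=> f g; apply/fsfunP => k.
pose D := [fset (k - b)%R | b in finsupp g]%fset.
rewrite (lmulEw (S := (finsupp f `|` D)%fset)) ?fsubsetUl // [RHS]lmulE.
rewrite -(big_fset_incl _ (fsubsetUr (finsupp f) D)) => /= [|a _ aD].
  rewrite big_imfset /= => [|a b _ _ /addrI/oppr_inj //].
  by apply: eq_bigr => b _; rewrite subKr mulrC.
case: (finsuppP g (k - a)) => [|kag]; first by rewrite mulr0.
by case/negP: aD; apply/imfsetP; exists (k - a); rewrite //= subKr.
Qed.

Lemma lmulA : associative lmul.
Proof.
move=> f g h; apply/fsfunP => k.
pose S := [fset (a + b)%R | a in finsupp f, b in finsupp g]%fset.
have fgS : (finsupp (lmul f g) `<=` S)%fset by exact: finsupp_sub.
rewrite (lmulEw _ _ fgS) lmulE.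
under [RHS]eq_bigr do rewrite lmulE mulr_suml.
rewrite exchange_big /= big_seq [RHS]big_seq; apply: eq_bigr => a af.
under [RHS]eq_bigr do rewrite -mulrA.
rewrite -mulr_sumr; congr (_ * _); rewrite lmulE.
pose T := [fset (a + b)%R | b in finsupp g]%fset.
have TS : (T `<=` S)%fset.
  by apply/fsubsetP => _ /imfsetP[b bg ->]; apply/imfset2P; exists a => //; exists b.
rewrite -(big_fset_incl _ TS) => /= [|c _ cT].
  rewrite big_imfset /= => [|b c _ _ /addrI //].
  by apply: eq_bigr => b _; rewrite [a + b - a]addrAC subrr add0r opprD addrA.
case: (finsuppP g (c - a)) => [|cag]; first by rewrite mul0r.
by case/negP: cT; apply/imfsetP; exists (c - a); rewrite //= addrC subrK.
Qed.

Lemma lmul1 : left_id lone lmul.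
Proof.
move=> f; apply/fsfunP => k.
have sub1 : (finsupp lone `<=` [fset 0])%fset by exact: finsupp_sub.
by rewrite (lmulEw _ _ sub1) big_seq_fset1 lmonomE eqxx mul1r subr0.
Qed.

Lemma lmulDl : left_distributive lmul ladd.
Proof.
move=> f g h; apply/fsfunP => k.
have sub : (finsupp (ladd f g) `<=` finsupp f `|` finsupp g)%fset.
  exact: finsupp_sub.
rewrite laddE (lmulEw _ _ sub) (lmulEw _ _ (fsubsetUl _ (finsupp g))).
rewrite (lmulEw _ _ (fsubsetUr (finsupp f) _)) -big_split /=.
by apply: eq_bigr => a _; rewrite laddE mulrDl.
Qed.

Lemma lone_neq0 : lone != lzero.
Proof. by apply/eqP => /fsfunP/(_ 0); rewrite lmonomE lzeroE eqxx. Qed.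

End LaurentRing.

HB.instance Definition _ p := GRing.isZmodule.Build (laurent p)
  (@laddA p) (@laddC p) (@ladd0 p) (@laddN p).

HB.instance Definition _ p := GRing.Zmodule_isComNzRing.Build (laurent p)
  (@lmulA p) (@lmulC p) (@lmul1 p) (@lmulDl p) (@lone_neq0 p).

Local Open Scope classical_set_scope.

Section Convexity.
Variables (R : realType) (E : lmodType R).

Definition conv_hull (A : set E) : set E :=
  [set x | exists (n : nat) (y : 'I_n -> E) (c : 'I_n -> R),
     [/\ forall i, A (y i), forall i, 0 <= c i, \sum_i c i = 1
       & x = \sum_i c i *: y i]].

Definition conic_hull (A : set E) : set E :=
  [set x | exists (n : nat) (y : 'I_n -> E) (c : 'I_n -> R),
     [/\ forall i, A (y i), forall i, 0 <= c i & x = \sum_i c i *: y i]].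

End Convexity.

Section Polytopes.
Variables (R : realType) (s : nat).
Implicit Types (P : set 'rV[R]_s) (a v : 'rV[int]_s)
  (sigma tau : {fset 'rV[int]_s}) (T : {fset {fset 'rV[int]_s}}).

Definition lattice_pt a : 'rV[R]_s := map_mx intr a.

Definition lattice_hull sigma : set 'rV[R]_s :=
  conv_hull [set lattice_pt v | v in [set` sigma]].

Definition lattice_polytope P := exists V : {fset 'rV[int]_s}, P = lattice_hull V.

Definition at_height (x : 'rV[R]_s) (t : R) : 'rV[R]_(s + 1) :=
  row_mx x (const_mx t).

Definition cone P : set 'rV[R]_(s + 1) :=
  conic_hull [set at_height (lattice_pt a) 1 | a in [set a | P (lattice_pt a)]].

Definition affinely_independent sigma :=
  forall c : 'rV[int]_s -> R,
    \sum_(v <- sigma) c v = 0 -> \sum_(v <- sigma) c v *: lattice_pt v = 0 ->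
    forall v, v \in sigma -> c v = 0.

(* A triangulation is encoded as the finite set of the vertex sets of all its
   simplices, of every dimension; the empty face is included. *)
Definition triangulation P T :=
  [/\ forall sigma, sigma \in T -> affinely_independent sigma,
      forall sigma tau, sigma \in T -> (tau `<=` sigma)%fset -> tau \in T,
      P = \bigcup_(sigma in [set` T]) lattice_hull sigma
    & forall sigma tau, sigma \in T -> tau \in T ->
        lattice_hull sigma `&` lattice_hull tau =
        lattice_hull (sigma `&` tau)%fset].

Definition maximal_simplex T sigma :=
  sigma \in T /\ forall tau, tau \in T -> (sigma `<=` tau)%fset -> tau = sigma.

Section Weights.
Variables (p : nat) (w : 'I_p -> {scalar 'rV[R]_s}).

Definition integral_weights := forall i a, w i (lattice_pt a) \is a Num.int.

(* The vector (w_1(a), ..., w_p(a)); the floor is exact for integral weights. *)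
Definition weight_vector a : 'rV[int]_p := \row_i Num.floor (w i (lattice_pt a)).

Definition compatible T :=
  forall sigma tau, maximal_simplex T sigma -> maximal_simplex T tau ->
    perm_eq [seq weight_vector v | v <- sigma] [seq weight_vector v | v <- tau].

(* The coefficient of x^n.  No lattice point of the cone has negative height;
   for a bounded P the sum is finite. *)
Definition weighted_ehrhart P (n : nat) : laurent p :=
  \sum_(a \in [set a | cone P (at_height (lattice_pt a) n%:R)])
    lmonom (weight_vector a).

End Weights.
End Polytopes.

Section RationalForm.
Variable p : nat.
Implicit Types (F : nat -> laurent p) (N D : {poly laurent p}).

(* The sum over n of (F n) x^n equals N / D, i.e. D times the series is N. *)
Definition series_eq_frac F N D :=
  forall n, \sum_(i < n.+1) D`_i * F (n - i)%N = N`_n.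

(* The only common divisors are the units; {poly laurent p} carries no
   unitRingType structure, so invertibility is spelled out. *)
Definition lowest_terms N D :=
  forall C N' D' : {poly laurent p},
    N = C * N' -> D = C * D' -> exists C' : {poly laurent p}, C * C' = 1.

Definition rational_form F N D :=
  [/\ series_eq_frac F N D, lowest_terms N D & D.[0] = 1].

Definition positive_coefficients N :=
  forall n b, lcoef N`_n b != 0 -> 0 < lcoef N`_n b.

Definition numerator_positive F :=
  (exists N D, rational_form F N D) /\
  (forall N D, rational_form F N D -> positive_coefficients N).

End RationalForm.

(* Main.v *)
Require Import Defs.
From HB Require Import structures.
From mathcomp Require Import all_boot all_order all_algebra finmap.
From mathcomp Require Import all_classical all_reals.
From mathcomp Require Import zify ring lra.

(** Every maximal simplex [sigma] of a compatible triangulation contributes the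
    same product [D] of the factors [1 - q^w(v) x], [v] a vertex of [sigma], as
    denominator. Cut the cone over the polytope into disjoint half-open
    simplicial cones: choose a generic point [y] of the cone and put a point
    [z] into the piece of [sigma] when [z + e y] lies in the cone over [sigma]
    for all small [e > 0] ([half_open_cover], [half_open_disjoint]). In the
    coordinates of [sigma] such a piece is given by [0 <= c v], or [0 < c v]
    where [y] has a negative coordinate.

    If a set [A] of lattice points is stable under translation by [v], then
    multiplying its generating function by [1 - q^w(v) x] gives the one of [A]
    minus its translate ([weight_gf_unshifted]). Doing this for every vertex of
    [sigma] leaves the generating function of a finite box, whose coefficients
    are nonnegative ([series_mul_half_open]). Summing over [sigma] writes the
    Ehrhart series as [N / D] with [N] nonnegative ([compatible_fraction]).

    This fraction is in lowest terms. Laurent polynomials form a domain, so a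
    common divisor of [N] and [D] that is not a unit would make some [x = q^-b]
    a root of [N]; but the value of [N] there is a nonzero sum of monomials
    ([pnonneg_nonroot]). By the same argument [N / D] is the only rational form
    ([rational_form_unique]).

    A compatible triangulation is not necessary: take the pyramid over the unit
    square and give [(a, b, c)] the weight [2 a + c] ([pyramid_fraction]). The
    series of the square itself has numerator
    [1 - q^2 x^2 = (1 - q x) (1 + q x)], and the apex, of weight [1], adds the
    factor [1 - q x] to the denominator. It cancels, which leaves the positive
    numerator [1 + q x]. A compatible triangulation would have a maximal simplex
    through the apex, hence a denominator divisible by [1 - q x]; uniqueness of
    the rational form excludes this ([pyramid_not_compatible]). *)

Set Implicit Arguments.
Unset Strict Implicit.
Unset Printing Implicit Defensive.

Import Order.TTheory GRing.Theory Num.Theory.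

Local Open Scope ring_scope.
Local Open Scope classical_set_scope.

(** * Laurent polynomials form a domain *)

Section Lexicographic.
Variable p : nat.
Implicit Types (a b c : 'rV[int]_p).

(** The positive cone of the lexicographic order on [Z^p], which is a total
    order compatible with addition. *)
Definition lex_pos a :=
  [exists i : 'I_p, (0 < a 0 i) && [forall j : 'I_p, (j < i)%N ==> (a 0 j == 0)]].

Lemma lex_posP a : reflect
  (exists2 i : 'I_p, 0 < a 0 i & forall j : 'I_p, (j < i)%N -> a 0 j = 0)
  (lex_pos a).
Proof.
apply: (iffP existsP) => [[i /andP[ai /forallP a0]]|[i ai a0]]; exists i => //.
  by move=> j ji; apply/eqP/(implyP (a0 j)).
by rewrite ai; apply/forallP => j; apply/implyP => /a0 ->.
Qed.

Lemma lex_posD a b : lex_pos a -> lex_pos b -> lex_pos (a + b).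
Proof.
move=> /lex_posP[i ai a0] /lex_posP[j bj b0]; apply/lex_posP.
case: (ltngtP i j) => [ij|ji|/val_inj ij].
- exists i => [|k ki]; first by rewrite mxE (b0 _ ij) addr0.
  by rewrite mxE a0 // b0 ?addr0 //; apply: ltn_trans ij.
- exists j => [|k kj]; first by rewrite mxE (a0 _ ji) add0r.
  by rewrite mxE b0 // a0 ?addr0 //; apply: ltn_trans ji.
- exists i => [|k ki]; first by rewrite mxE addr_gt0 // ij.
  by rewrite mxE a0 // b0 ?addr0 // -ij.
Qed.

Lemma lex_pos0 : ~~ lex_pos 0.
Proof. by apply/lex_posP => -[i]; rewrite mxE ltxx. Qed.

Lemma lex_pos_total a : a != 0 -> lex_pos a || lex_pos (- a).
Proof.
move=> a_neq0.
have [i0 ai0] : exists i, a 0 i != 0.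
  apply/existsP; apply: contraR a_neq0 => /existsPn a0.
  by apply/eqP/rowP => i; rewrite mxE; apply/eqP; rewrite -[_ == _]negbK a0.
case: (@arg_minnP _ i0 (fun i => a 0 i != 0) (fun i : 'I_p => i : nat) ai0) => i ai imin.
have below (j : 'I_p) : (j < i)%N -> a 0 j = 0.
  by rewrite ltnNge => ji; apply: contraNeq ji => /imin.
have [ai_gt0|ai_lt0|ai0'] := ltrgt0P (a 0 i); last by rewrite ai0' eqxx in ai.
  by apply/orP; left; apply/lex_posP; exists i.
apply/orP; right; apply/lex_posP; exists i => [|j ji]; rewrite mxE ?oppr_gt0 //.
by rewrite below ?oppr0.
Qed.

Lemma lex_max (s : seq 'rV[int]_p) a0 : a0 \in s ->
  exists2 m, m \in s & forall a, a \in s -> a != m -> lex_pos (m - a).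
Proof.
elim: s a0 => // b s IHs a0 _.
case: s IHs => [_|c s /(_ c (mem_head _ _)) [m ms mmax]].
  by exists b => [|a]; rewrite !inE // => ->.
have [->|bm] := eqVneq b m.
  exists m => [|a]; first exact: mem_head.
  by rewrite inE => /predU1P[->|/mmax //]; rewrite eqxx.
have := lex_pos_total (a := m - b); rewrite subr_eq0 eq_sym bm opprB.
case/(_ isT)/orP => [mb|bm_pos].
  exists m => [|a]; first by rewrite inE ms orbT.
  by rewrite inE => /predU1P[->|/mmax].
exists b => [|a]; first exact: mem_head.
rewrite inE => /predU1P[->|/mmax am _]; first by rewrite eqxx.
have [->//|/am ma] := eqVneq a m.
by have := lex_posD bm_pos ma; rewrite addrA subrK.
Qed.

End Lexicographic.

Section LaurentDomain.
Variable p : nat.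
Implicit Types (f g : laurent p) (a b k : 'rV[int]_p).

Lemma lcoef0 b : lcoef (0 : laurent p) b = 0. Proof. exact: lzeroE. Qed.

Lemma lcoefD f g b : lcoef (f + g) b = lcoef f b + lcoef g b.
Proof. exact: laddE. Qed.

Lemma lcoefM f g b :
  lcoef (f * g) b = \sum_(a <- finsupp f) lcoef f a * lcoef g (b - a).
Proof. exact: lmulE. Qed.

Lemma lcoef_mon a b : lcoef (lmonom a) b = (b == a)%:R.
Proof. exact: lmonomE. Qed.

Lemma lcoef_sum (I : Type) (r : seq I) (Q : pred I) (F : I -> laurent p) b :
  lcoef (\sum_(i <- r | Q i) F i) b = \sum_(i <- r | Q i) lcoef (F i) b.
Proof.
by elim/big_rec2: _ => [|i x y _ <-]; rewrite ?lcoef0 // lcoefD.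
Qed.

Lemma laurent_eq0 f : (forall b, lcoef f b = 0) -> f = 0.
Proof. by move=> f0; apply/fsfunP => b; rewrite [LHS]f0 [RHS]lcoef0. Qed.

Lemma finsupp_nonempty f : f != 0 -> exists a, a \in finsupp f.
Proof.
move=> fn0; case: (fset_0Vmem (finsupp f)) => [f0|[a]]; last by exists a.
by case/eqP: fn0; apply: laurent_eq0 => b; apply: fsfun_dflt; rewrite f0 in_fset0.
Qed.

Lemma lmonomM a b : lmonom a * lmonom b = lmonom (a + b) :> laurent p.
Proof.
apply/fsfunP => k; rewrite [LHS](lmulEw _ _ (S := [fset a]%fset)) ?finsupp_sub //.
by rewrite big_seq_fset1 !lmonomE eqxx mul1r subr_eq addrC.
Qed.

Lemma lmonom0 : lmonom 0 = 1 :> laurent p. Proof. by []. Qed.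

Lemma lmonomX a n : lmonom a ^+ n = lmonom (a *+ n) :> laurent p.
Proof. by elim: n => [|n IH]; rewrite ?expr0 ?mulr0n // exprS IH lmonomM mulrS. Qed.

(** Multiplying the lexicographically leading terms of two nonzero elements
    gives a term of the product that no other pair of terms can cancel. *)
Lemma laurent_integral f g : f * g = 0 -> (f == 0) || (g == 0).
Proof.
apply: contra_eqT; rewrite negb_or => /andP[/finsupp_nonempty[a0 fa0]].
move=> /finsupp_nonempty[b0 gb0].
have [a fa amax] := lex_max fa0; have [b gb bmax] := lex_max gb0.
apply/eqP => fg0; have := lcoef0 (a + b); rewrite -fg0 lcoefM.
rewrite (big_fsetD1 a) //= big_seq big1 => [|c]; last first.
  rewrite in_fsetD1 => /andP[ca fc]; case: (finsuppP g (a + b - c)) => [|].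
    by rewrite /lcoef => /fsfun_dflt ->; rewrite mulr0.
  move=> gabc; have := amax _ fc ca; have : a + b - c != b.
    by rewrite -subr_eq0 addrAC addrK subr_eq0 eq_sym.
  move=> /(bmax _ gabc) /lex_posD/[apply].
  have -> : b - (a + b - c) + (a - c) = 0.
    by apply/rowP => i; rewrite !mxE; ring.
  by rewrite (negbTE (lex_pos0 p)).
rewrite addr0 addrAC subrr add0r => /eqP; rewrite mulf_eq0.
by rewrite /lcoef -[f a == 0]negbK -[g b == 0]negbK -!mem_finsupp fa gb.
Qed.

(** The inverses below exist only to give the ring its unit structure, which
    the theory of polynomials over a domain presupposes. *)
Definition laurent_unit : pred (laurent p) := fun f => `[< exists g, g * f = 1 >].

Definition laurent_inv f :=
  if pselect (exists g, g * f = 1) is left ex then projT1 (cid ex) else f.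

Lemma laurent_mulVx : {in laurent_unit, left_inverse 1 laurent_inv *%R}.
Proof.
move=> f /asboolP ex; rewrite /laurent_inv.
by case: pselect => // ex'; case: cid.
Qed.

Lemma laurent_unitPl f g : g * f = 1 -> laurent_unit f.
Proof. by move=> gf1; apply/asboolP; exists g. Qed.

Lemma laurent_invr_out : {in [predC laurent_unit], laurent_inv =1 id}.
Proof.
move=> f /= /asboolP nex; rewrite /laurent_inv.
by case: pselect.
Qed.

End LaurentDomain.

HB.instance Definition _ p := GRing.ComNzRing_hasMulInverse.Build (laurent p)
  (@laurent_mulVx p) (@laurent_unitPl p) (@laurent_invr_out p).

HB.instance Definition _ p := GRing.ComUnitRing_isIntegral.Build (laurent p)
  (@laurent_integral p).

(** * Products of polynomials and power series *)

Section PowerSeries.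
Variable p : nat.
Implicit Types (F G : nat -> laurent p) (C D E N : {poly laurent p}).

Definition series_mul D F n : laurent p := \sum_(i < n.+1) D`_i * F (n - i)%N.

(** Truncations reduce the associativity of this product to that of
    polynomials. *)
Definition truncation m F : {poly laurent p} := \poly_(i < m) F i.

Lemma series_mul_truncation D F m n : (n < m)%N ->
  series_mul D F n = (D * truncation m F)`_n.
Proof.
move=> nm; rewrite coefM; apply: eq_bigr => i _; rewrite coef_poly ifT //.
by apply: leq_ltn_trans nm; apply: leq_subr.
Qed.

Lemma series_mulA D E F :
  series_mul (D * E) F =1 series_mul D (series_mul E F).
Proof.
move=> n; rewrite (series_mul_truncation _ _ (ltnSn n)) -mulrA coefM.
apply: eq_bigr => i _; congr (_ * _); rewrite -series_mul_truncation //.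
by rewrite ltnS leq_subr.
Qed.

Lemma series_mul_poly D E : series_mul D (fun n => E`_n) =1 (fun n => (D * E)`_n).
Proof. by move=> n; rewrite coefM. Qed.

Lemma eq_series_mul D F G : F =1 G -> series_mul D F =1 series_mul D G.
Proof. by move=> FG n; apply: eq_bigr => i _; rewrite FG. Qed.

Lemma series_mul_sum (I : Type) (r : seq I) (Q : pred I) D
    (F : I -> nat -> laurent p) n :
  series_mul D (fun m => \sum_(i <- r | Q i) F i m) n =
  \sum_(i <- r | Q i) series_mul D (F i) n.
Proof.
by rewrite exchange_big /=; apply: eq_bigr => i _; rewrite mulr_sumr.
Qed.

Lemma series_mul1 F : series_mul 1 F =1 F.
Proof.
move=> n; rewrite /series_mul big_ord_recl coef1 mul1r subn0 big1 ?addr0 //.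
by move=> i _; rewrite coef1 mul0r.
Qed.

Lemma series_mul_at0 D F : series_mul D F 0 = D`_0 * F 0.
Proof. by rewrite /series_mul big_ord_recl big_ord0 addr0. Qed.

Definition pole (b : 'rV[int]_p) : {poly laurent p} := 1 - (lmonom b)%:P * 'X.

Lemma coef_pole b n :
  (pole b)`_n = if n is m.+1 then if m is 0 then - lmonom b else 0 else 1.
Proof.
by rewrite coefB coef1 coefMX coefC; case: n => [|[|n]] /=; rewrite ?subr0 ?sub0r ?oppr0.
Qed.

Lemma pole_neq0 b : pole b != 0.
Proof.
by apply/eqP => /(congr1 (fun D : {poly _} => D`_0))/eqP; rewrite coef_pole coef0 oner_eq0.
Qed.

Lemma series_mul_pole b F n :
  series_mul (pole b) F n = if n is m.+1 then F n - lmonom b * F m else F 0.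
Proof.
case: n => [|n]; first by rewrite series_mul_at0 coef_pole mul1r.
rewrite /series_mul 2!big_ord_recl big1 => [|i _]; last by rewrite coef_pole mul0r.
by rewrite !coef_pole mul1r subn0 subSS subn0 addr0 mulNr.
Qed.

(** The constant term of [pole b] is [1], so the coefficients can be recovered
    one after the other. *)
Lemma series_mul_pole_inj b F G :
  series_mul (pole b) F =1 series_mul (pole b) G -> F =1 G.
Proof.
move=> FG; elim=> [|n IHn]; have := FG 0%N; rewrite ?series_mul_pole //.
by have := FG n.+1; rewrite !series_mul_pole IHn => /subIr.
Qed.

Lemma horner_pole b c : (pole b).[lmonom c] = 1 - lmonom (b + c).
Proof. by rewrite !hornerE lmonomM. Qed.

Lemma root_poleP b C : reflect (exists C', C = pole b * C') (root C (lmonom (- b))).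
Proof.
have polE : pole b = (- lmonom b)%:P * ('X - (lmonom (- b))%:P).
  by rewrite mulrBr -polyCM mulNr lmonomM subrr lmonom0 !polyCN mulNr opprK addrC.
apply: (iffP (factor_theorem C _)) => -[C' ->].
  exists (C' * (- lmonom (- b))%:P); rewrite polE.
  have : (- lmonom b)%:P * (- lmonom (- b))%:P = 1 :> {poly laurent p}.
    by rewrite -polyCM mulrNN lmonomM subrr lmonom0.
  move: (- lmonom b)%:P (- lmonom (- b))%:P ('X - _) => u v f uv.
  by rewrite -[LHS]mul1r -uv; ring.
by exists (C' * (- lmonom b)%:P); rewrite polE mulrC mulrA.
Qed.

Lemma root_pole b : root (pole b) (lmonom (- b)).
Proof. by apply/root_poleP; exists 1; rewrite mulr1. Qed.

Definition poles (bs : seq 'rV[int]_p) : {poly laurent p} := \prod_(b <- bs) pole b.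

Lemma poles_cons b bs : poles (b :: bs) = pole b * poles bs.
Proof. exact: big_cons. Qed.

Lemma series_mul_poles bs F :
  series_mul (poles bs) F =1 foldr (fun b => series_mul (pole b)) F bs.
Proof.
elim: bs => [|b bs IH] n; first by rewrite /poles big_nil series_mul1.
by rewrite poles_cons series_mulA; apply: eq_series_mul.
Qed.

Lemma poles_at0 bs : (poles bs)`_0 = 1.
Proof.
elim: bs => [|b bs IH]; first by rewrite /poles big_nil coef1.
by rewrite poles_cons coefM big_ord_recl big_ord0 coef_pole IH mul1r addr0.
Qed.

Lemma root_poles bs b : root (poles bs) (lmonom (- b)) = (b \in bs).
Proof.
elim: bs => [|c bs IH]; first by rewrite /poles big_nil (negbTE (root1 _)).
rewrite poles_cons rootM IH inE; congr (_ || _).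
rewrite /root horner_pole subr_eq0; apply/eqP/eqP => [|->]; last by rewrite subrr.
move/(congr1 (fun f => lcoef f 0)); rewrite -lmonom0 !lcoef_mon eqxx eq_sym.
by case: (_ =P 0) => // /eqP; rewrite subr_eq0 => /eqP.
Qed.

End PowerSeries.

(** * Fractions with nonnegative numerator are in lowest terms *)

Section PositiveNumerators.
Variable p : nat.
Implicit Types (F : nat -> laurent p) (C D E N : {poly laurent p}) (f : laurent p).

Definition lnonneg f := forall b, 0 <= lcoef f b.

Lemma lnonneg_mon b : lnonneg (lmonom b).
Proof. by move=> c; rewrite lcoef_mon ler0n. Qed.

Lemma lnonnegM f g : lnonneg f -> lnonneg g -> lnonneg (f * g).
Proof. by move=> f0 g0 b; rewrite lcoefM sumr_ge0 // => a _; rewrite mulr_ge0. Qed.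

Lemma lnonneg_sum (I : Type) (r : seq I) (Q : pred I) (f : I -> laurent p) :
  (forall i, Q i -> lnonneg (f i)) -> lnonneg (\sum_(i <- r | Q i) f i).
Proof. by move=> f0 b; rewrite lcoef_sum sumr_ge0 // => i /f0. Qed.

Definition pnonneg N := forall n, lnonneg N`_n.

(** The value at [x = q^c] is a sum of Laurent polynomials without negative
    coefficients, one of which is the constant term [1]. *)
Lemma pnonneg_nonroot N c : pnonneg N -> N`_0 = 1 -> ~~ root N (lmonom c).
Proof.
move=> N0 N1; apply/negP => /eqP /(congr1 (fun f => lcoef f 0)).
rewrite lcoef0 horner_coef lcoef_sum; have : (0 < size N)%N.
  rewrite lt0n size_poly_eq0; apply/eqP => NE; move: N1; rewrite NE coef0 => /eqP.
  by rewrite eq_sym oner_eq0.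
case: (size N) => // m _; rewrite big_ord_recl expr0 mulr1 N1 -lmonom0 lcoef_mon eqxx.
apply/eqP; rewrite gt_eqF // ltr_pwDl ?ltr01 // sumr_ge0 // => i _.
by apply: lnonnegM => //; rewrite lmonomX; apply: lnonneg_mon.
Qed.

(** Each factor [pole b] is prime: it divides a polynomial exactly when
    [q^-b] is a root. If it does not divide [C], it divides the cofactor [E]
    and can be removed from both sides. *)
Lemma divisor_poles_unit bs C E : C * E = poles bs ->
  (forall b, b \in bs -> ~~ root C (lmonom (- b))) -> exists C', C * C' = 1.
Proof.
rewrite /poles; elim: bs E => [|b bs IH] E.
  by rewrite big_nil => CE _; exists E.
rewrite big_cons => CE nroot.
have : root (C * E) (lmonom (- b)) by rewrite CE rootM root_pole.
rewrite rootM (negbTE (nroot _ (mem_head _ _))) => /root_poleP[E' EE].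
apply: (IH E') => [|c cbs]; last by apply: nroot; rewrite inE cbs orbT.
by apply: (mulfI (pole_neq0 b)); rewrite -CE EE mulrCA.
Qed.

(** In the cross-multiplied equality of two fractions the factors of [D] do not
    divide [N], so they all divide [D2]. *)
Lemma poles_cancel bs D N D2 N2 : D = poles bs ->
  (forall b, ~~ root N (lmonom b)) -> D2 * N = D * N2 ->
  exists2 G, D2 = G * D & N2 = G * N.
Proof.
move=> -> nroot; rewrite /poles; elim: bs D2 => [|b bs IH] D2.
  by rewrite big_nil mul1r => <-; exists D2; rewrite ?mulr1.
rewrite big_cons => DN.
have : root (D2 * N) (lmonom (- b)).
  by rewrite DN !rootM root_pole.
rewrite rootM (negbTE (nroot _)) orbF => /root_poleP[D3 D2E].
have /IH[G D3E N2E] : D3 * N = \prod_(c <- bs) pole c * N2.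
  by apply: (mulfI (pole_neq0 b)); rewrite mulrA -D2E DN mulrA.
by exists G => //; rewrite D2E D3E mulrCA.
Qed.

Lemma numerator_at0 F N bs : F 0 = 1 -> series_eq_frac F N (poles bs) -> N`_0 = 1.
Proof. by move=> F0 <-; rewrite -/(series_mul _ _ 0) series_mul_at0 poles_at0 F0 mulr1. Qed.

(** No factor [1 - q^b x] of the denominator can divide a numerator with
    nonnegative coefficients, so nothing cancels in such a fraction. *)
Lemma positive_rational_form F N bs : pnonneg N -> F 0 = 1 ->
  series_eq_frac F N (poles bs) -> rational_form F N (poles bs).
Proof.
move=> N0 F0 FN.
have N1 := numerator_at0 F0 FN.
split=> //; last by rewrite horner_coef0 poles_at0.
move=> C N' D' NE DE; apply: (@divisor_poles_unit bs C D') => // b _.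
have := pnonneg_nonroot (- b) N0 N1.
by rewrite NE rootM negb_or => /andP[].
Qed.

(** The common factor left by [poles_cancel] is a unit because the other
    fraction is in lowest terms, and the units of [{poly laurent p}] are
    constant; the constant terms of the denominators then fix it to [1]. *)
Lemma rational_form_unique F N bs N2 D2 : pnonneg N -> F 0 = 1 ->
  series_eq_frac F N (poles bs) -> rational_form F N2 D2 -> N2 = N /\ D2 = poles bs.
Proof.
move=> N0 F0 FN [FN2 low D2_0].
have N1 := numerator_at0 F0 FN.
have DN : D2 * N = poles bs * N2.
  apply/polyP => n; rewrite -!series_mul_poly.
  rewrite -(eq_series_mul D2 FN) -(eq_series_mul (poles bs) FN2).
  by rewrite -!series_mulA mulrC.
have [G D2E N2E] := poles_cancel erefl (fun b => pnonneg_nonroot b N0 N1) DN.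
have [G' GG'] := low _ _ _ N2E D2E.
have G1 : G = 1.
  have : size (G * G') == 1 by rewrite GG' size_poly1.
  rewrite size_mul_eq1 => /andP[/size_poly1P[c _ GE] _].
  by move: D2_0; rewrite D2E GE hornerM hornerC horner_coef0 poles_at0 mulr1 => ->.
by rewrite D2E N2E G1 !mul1r.
Qed.

Lemma positive_fraction_numerator F N bs : pnonneg N -> F 0 = 1 ->
  series_eq_frac F N (poles bs) -> numerator_positive F.
Proof.
move=> N0 F0 FN; split; first by exists N, (poles bs); apply: positive_rational_form.
move=> N2 D2 /(rational_form_unique N0 F0 FN)[-> _] n b.
by rewrite lt0r => ->; apply: N0.
Qed.

End PositiveNumerators.

(** * Cones over finite sets of lattice points *)

Section Cones.
Variables (R : realType) (s : nat).
Implicit Types (P : set 'rV[R]_s) (a v : 'rV[int]_s) (x y : 'rV[R]_s)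
  (A B V sigma tau : {fset 'rV[int]_s}) (T : {fset {fset 'rV[int]_s}})
  (c d : 'rV[int]_s -> R) (z : 'rV[R]_(s + 1)) (t : R).

Lemma at_heightD x y t u : at_height x t + at_height y u = at_height (x + y) (t + u).
Proof. by rewrite /at_height add_row_mx; congr row_mx; apply/rowP => i; rewrite !mxE. Qed.

Lemma at_heightZ x t u : u *: at_height x t = at_height (u *: x) (u * t).
Proof. by rewrite /at_height scale_row_mx; congr row_mx; apply/rowP => i; rewrite !mxE. Qed.

Lemma at_height00 : at_height 0 0 = 0 :> 'rV[R]_(s + 1).
Proof. by rewrite /at_height -[RHS]row_mx0; congr row_mx; apply/rowP => i; rewrite !mxE. Qed.

Lemma at_height_inj x y t u : at_height x t = at_height y u -> x = y /\ t = u.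
Proof. by move=> /eq_row_mx[-> /rowP/(_ 0)]; rewrite !mxE => ->. Qed.

Lemma at_height_surj z : exists x t, z = at_height x t.
Proof.
exists (lsubmx z), (rsubmx z 0 0); rewrite -[LHS]hsubmxK; congr row_mx.
by apply/rowP => i; rewrite !mxE !ord1.
Qed.

Lemma lattice_ptD a b : lattice_pt R (a + b) = lattice_pt R a + lattice_pt R b.
Proof. by rewrite /lattice_pt map_mxD. Qed.

Lemma lattice_pt_inj : injective (@lattice_pt R s).
Proof. by move=> a b /rowP ab; apply/rowP => i; have := ab i; rewrite !mxE => /intr_inj. Qed.

Definition homog a (n : nat) : 'rV[R]_(s + 1) := at_height (lattice_pt R a) n%:R.

Definition comb A c : 'rV[R]_(s + 1) := \sum_(v <- A) c v *: homog v 1.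

Definition cone_over A : set 'rV[R]_(s + 1) :=
  [set z | exists2 c, (forall v, v \in A -> 0 <= c v) & z = comb A c].

Lemma combE A c :
  comb A c = at_height (\sum_(v <- A) c v *: lattice_pt R v) (\sum_(v <- A) c v).
Proof.
rewrite /comb; elim/big_rec3: _ => [|v x y t _ ->]; first by rewrite at_height00.
by rewrite at_heightZ mulr1 at_heightD.
Qed.

Lemma combD A c d : comb A (fun v => c v + d v) = comb A c + comb A d.
Proof. by rewrite -big_split; apply: eq_bigr => v _; rewrite scalerDl. Qed.

Lemma combZ A t c : comb A (fun v => t * c v) = t *: comb A c.
Proof. by rewrite scaler_sumr; apply: eq_bigr => v _; rewrite scalerA. Qed.

Lemma eq_comb A c d : {in A, c =1 d} -> comb A c = comb A d.
Proof. by move=> cd; apply: eq_big_seq => v /cd ->. Qed.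

Lemma comb0 A c : {in A, forall v, c v = 0} -> comb A c = 0.
Proof. by move=> c0; rewrite /comb big_seq big1 // => v /c0 ->; rewrite scale0r. Qed.

Lemma comb_delta A v : v \in A -> comb A (fun u => (u == v)%:R) = homog v 1.
Proof.
move=> vA; rewrite /comb (big_fsetD1 v) //= eqxx scale1r big_seq big1 ?addr0 //.
by move=> u; rewrite in_fsetD1 => /andP[/negbTE -> _]; rewrite scale0r.
Qed.

Definition extension0 A c v : R := if v \in A then c v else 0.

Lemma comb_widen A B c : (A `<=` B)%fset -> comb A c = comb B (extension0 A c).
Proof.
move=> AB; rewrite /comb -(big_fset_incl _ AB) => /= [|v _ vA].
  by apply: eq_big_seq => v vA; rewrite /extension0 vA.
by rewrite /extension0 (negbTE vA) scale0r.
Qed.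

Lemma cone_overD A z1 z2 : cone_over A z1 -> cone_over A z2 ->
  cone_over A (z1 + z2).
Proof.
move=> [c c0 ->] [d d0 ->]; exists (fun v => c v + d v); last by rewrite combD.
by move=> v vA; rewrite addr_ge0 ?c0 ?d0.
Qed.

Lemma cone_overZ A t z : 0 <= t -> cone_over A z -> cone_over A (t *: z).
Proof.
move=> t0 [c c0 ->]; exists (fun v => t * c v); last by rewrite combZ.
by move=> v vA; rewrite mulr_ge0 ?c0.
Qed.

Lemma cone_over0 A : cone_over A 0.
Proof. by exists (fun=> 0) => //; rewrite comb0. Qed.

Lemma cone_over_mono A B : (A `<=` B)%fset -> cone_over A `<=` cone_over B.
Proof.
move=> AB z [c c0 ->]; exists (extension0 A c); last exact: comb_widen.
by move=> v _; rewrite /extension0; case: ifP => // /c0.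
Qed.

Lemma cone_over_gen A v : v \in A -> cone_over A (homog v 1).
Proof. by move=> vA; exists (fun u => (u == v)%:R); rewrite ?comb_delta. Qed.

Lemma lattice_hullP A x : lattice_hull A x <-> exists c,
  [/\ forall v, v \in A -> 0 <= c v, \sum_(v <- A) c v = 1
    & x = \sum_(v <- A) c v *: lattice_pt R v].
Proof.
split=> [[n [y [c [Ay c0 c1 ->]]]]|[c [c0 c1 ->]]].
  have /choice[f fP] i : exists v, v \in A /\ lattice_pt R v = y i.
    by have [v vA vy] := Ay i; exists v.
  have fibers (M : nmodType) (g : 'I_n -> M) :
      \sum_(v <- A) \sum_(i | f i == v) g i = \sum_i g i.
    rewrite (exchange_big_dep predT) //=; apply: eq_bigr => i _.
    rewrite big_mkcond (big_fsetD1 (f i)) ?(fP i).1 //= eqxx big_seq big1 ?addr0 // => v.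
    by rewrite in_fsetD1 eq_sym => /andP[/negbTE ->].
  exists (fun v => \sum_(i | f i == v) c i); split=> [v _||].
  - exact: sumr_ge0.
  - by rewrite fibers.
  - under [RHS]eq_bigr do rewrite scaler_suml.
    rewrite -fibers; apply: eq_bigr => v _; apply: eq_bigr => i /eqP <-.
    by rewrite (fP i).2.
pose r : seq _ := A.
exists (size r), (fun i => lattice_pt R (nth 0 r i)), (fun i => c (nth 0 r i)).
split=> [i|i||].
- by exists (nth 0 r i) => //; apply: mem_nth.
- by apply: c0; apply: mem_nth.
- by rewrite -c1 (big_nth 0) big_mkord.
- by rewrite (big_nth 0) big_mkord.
Qed.

Lemma lattice_hull_cone A x : lattice_hull A x <-> cone_over A (at_height x 1).
Proof.
split=> [/lattice_hullP[c [c0 c1 ->]]|[c c0]].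
  by exists c; rewrite // combE c1.
by rewrite combE => /at_height_inj[-> c1]; apply/lattice_hullP; exists c.
Qed.

Lemma cone_over_hull A x t : 0 < t ->
  cone_over A (at_height x t) <-> lattice_hull A (t^-1 *: x).
Proof.
move=> t0; have tV : 0 <= t^-1 by rewrite invr_ge0 ltW.
rewrite lattice_hull_cone; split=> [/(cone_overZ tV)|/(cone_overZ (ltW t0))].
  by rewrite at_heightZ mulVf ?gt_eqF.
by rewrite at_heightZ mulr1 scalerA mulfV ?gt_eqF // scale1r.
Qed.

Lemma cone_over_height A x t : cone_over A (at_height x t) ->
  0 <= t /\ (t = 0 -> x = 0).
Proof.
move=> [c c0]; rewrite combE => /at_height_inj[-> ->]; split.
  by rewrite big_seq sumr_ge0.
move=> sc; rewrite big_seq big1 // => v vA.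
suff -> : c v = 0 by rewrite scale0r.
move/eqP: sc; rewrite (big_fsetD1 v) //= paddr_eq0 ?c0 //; first by case/andP => /eqP.
by rewrite big_seq sumr_ge0 // => u; rewrite in_fsetD1 => /andP[_ /c0].
Qed.

Lemma lattice_hull_vertex A v : v \in A -> lattice_hull A (lattice_pt R v).
Proof. by move=> vA; apply/lattice_hull_cone; apply: cone_over_gen. Qed.

Lemma cone_lattice_hull V : cone (lattice_hull V : set 'rV[R]_s) = cone_over V.
Proof.
apply/seteqP; split=> [z [n [y [c [Py c0 ->]]]]|z [c c0 ->]].
  elim/big_rec: _ => [|i u _]; first exact: cone_over0.
  apply: cone_overD; apply: cone_overZ => //.
  by have [a /= /lattice_hull_cone Pa <-] := Py i.
pose r : seq _ := V.
exists (size r), (fun i => homog (nth 0 r i) 1), (fun i => c (nth 0 r i)).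
split=> [i|i|].
- by exists (nth 0 r i) => //=; apply/lattice_hull_vertex/mem_nth.
- by apply: c0; apply: mem_nth.
- by rewrite /comb (big_nth 0) big_mkord.
Qed.

Lemma homog_cone0 V a : cone_over V (homog a 0) <-> a = 0.
Proof.
have E0 : homog 0 0 = 0.
  by rewrite /homog /lattice_pt map_mx0 at_height00.
split=> [/cone_over_height[_ /(_ erefl)]|->]; last first.
  by rewrite E0; apply: cone_over0.
by move=> a0; apply: lattice_pt_inj; rewrite a0 /lattice_pt map_mx0.
Qed.

Lemma homogD a b m n : homog (a + b) (m + n) = homog a m + homog b n.
Proof. by rewrite /homog lattice_ptD natrD at_heightD. Qed.

Lemma homogS a v n : homog (a + v) n.+1 = homog a n + homog v 1.
Proof. by rewrite -homogD; congr homog; rewrite addn1. Qed.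

End Cones.

(** * Weighted generating functions of lattice points *)

Section LatticePoints.
Variables (R : realType) (s : nat).
Implicit Types (a v : 'rV[int]_s) (V : {fset 'rV[int]_s}).

Lemma finite_int_box M : finite_set [set a : 'rV[int]_s | forall j, (`|a 0%R j| <= M)%N].
Proof.
pose f (g : {ffun 'I_s -> 'I_(M + M).+1}) : 'rV[int]_s := \row_j ((g j)%:Z - M%:Z).
apply: (@sub_finite_set _ _ (f @` setT)); last exact/finite_image/finite_finset.
move=> a aM; exists [ffun j => inord `|(a 0 j + M%:Z)%R|%N] => //.
apply/rowP => j; rewrite mxE ffunE inordK; have := aM j; last lia.
by move=> /= ?; lia.
Qed.

(** The coordinates of a point of height [n] are bounded by [n] times those of
    the generators, since the coefficients of the generators add up to [n]. *)
Lemma cone_fiber_finite V n :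
  finite_set [set a | cone_over V (homog R a n)].
Proof.
pose B := (\sum_(v <- V) \sum_j `|v 0%R j|)%N.
apply: sub_finite_set (finite_int_box (n * B)) => a [c c0].
rewrite combE => /at_height_inj[aE nE] j.
have : `|(a 0 j)%:~R : R| <= (n * B)%:R.
  have -> : (a 0 j)%:~R = lattice_pt R a 0 j by rewrite mxE.
  rewrite aE summxE natrM nE mulr_suml big_seq [leRHS]big_seq.
  apply: (le_trans (ler_norm_sum _ _ _)); apply: ler_sum => v vV.
  rewrite !mxE normrM ger0_norm ?c0 // ler_wpM2l ?c0 //.
  rewrite -intr_norm -natr_absz ler_nat /B (big_fsetD1 v) //= (bigD1 j) //=.
  by rewrite -addnA leq_addr.
by rewrite -intr_norm -natr_absz ler_nat.
Qed.

End LatticePoints.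

(** Both sides equal a double sum over the finite set [S] and over [r], in which
    every point of [S] occurs for exactly one index. *)
Lemma fsbig_partition (T : choiceType) (I : eqType) (M : nmodType) (r : seq I)
    (S : set T) (A : I -> set T) (F : T -> M) :
  uniq r -> finite_set S -> (forall i, i \in r -> A i `<=` S) ->
  (forall a, S a -> exists2 i, i \in r & A i a) ->
  (forall i j a, i \in r -> j \in r -> A i a -> A j a -> i = j) ->
  \sum_(a \in S) F a = \sum_(i <- r) \sum_(a \in A i) F a.
Proof.
move=> r_uniq Sfin AS Acover Adisj.
have widen i : i \in r -> \sum_(a \in A i) F a =
    \sum_(a <- fset_set S) if `[< A i a >] then F a else 0.
  move=> ir; have Afin := sub_finite_set (AS i ir) Sfin.
  have sub : (fset_set (A i) `<=` fset_set S)%fset.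
    by apply/fsubsetP => a; rewrite !in_fset_set // !inE => /AS; apply.
  rewrite fsbig_finite // -(big_fset_incl _ sub) => [|a _] /=.
    by apply: eq_big_seq => a; rewrite in_fset_set // inE => Aa; case: asboolP.
  by rewrite in_fset_set // => aA; case: asboolP => // Aia; case/negP: aA; rewrite inE.
rewrite fsbig_finite // [RHS](eq_big_seq _ widen) exchange_big /=.
apply: eq_big_seq => a; rewrite in_fset_set // inE => /Acover[i ir Aia].
rewrite (bigD1_seq i) //= big_seq_cond; case: asboolP => // _.
rewrite big1 ?addr0 // => j /andP[jr ji]; case: asboolP => // Aja.
by case/eqP: ji; apply: Adisj Aja Aia.
Qed.

Section GeneratingFunctions.
Variables (R : realType) (s p : nat) (w : 'I_p -> {scalar 'rV[R]_s}).
Hypothesis w_int : integral_weights w.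
Implicit Types (a v : 'rV[int]_s) (A : nat -> set 'rV[int]_s).

Local Notation wt := (weight_vector w).

Lemma weight_vectorD a b : wt (a + b) = wt a + wt b.
Proof.
by apply/rowP => i; rewrite !mxE lattice_ptD raddfD /= floorDzr //; apply: w_int.
Qed.

Definition weight_gf A n : laurent p := \sum_(a \in A n) lmonom (wt a).

Lemma weight_gf_nonneg A n : lnonneg (weight_gf A n).
Proof. by apply: lnonneg_sum => a _; apply: lnonneg_mon. Qed.

Lemma eq_weight_gf A A' n : A n = A' n -> weight_gf A n = weight_gf A' n.
Proof. by rewrite /weight_gf => ->. Qed.

Definition unshifted v A n : set 'rV[int]_s :=
  if n is m.+1 then A n `\` [set a + v | a in A m] else A 0%N.

(** The product subtracts from [A] its translate by [v], one level higher. *)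
Lemma weight_gf_unshifted v A : (forall n, finite_set (A n)) ->
  (forall n a, A n a -> A n.+1 (a + v)) ->
  series_mul (pole (wt v)) (weight_gf A) =1 weight_gf (unshifted v A).
Proof.
move=> Afin Av [|n]; rewrite series_mul_pole // /weight_gf /=.
set B := [set a + v | a in A n].
have BA : B `<=` A n.+1 by move=> _ [a /Av Aa <-].
have Bfin : finite_set B by apply: sub_finite_set BA _.
rewrite -{1}(setDUK BA) fsbigU0 //=; last by move=> a [? []].
  rewrite fsbig_image => [|a b _ _ /addIr //].
  rewrite mulr_fsumr; under eq_fsbigr do rewrite weight_vectorD addrC -lmonomM.
  by rewrite addrAC subrr add0r.
exact: finite_setD.
Qed.

End GeneratingFunctions.

(** * Generic points *)

Section Eventually.
Variable R : realType.

Definition for_small (Q : R -> Prop) := exists2 eps : R, 0 < eps &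
  forall e, 0 < e <= eps -> Q e.

Lemma for_small_all (I : eqType) (r : seq I) (Q : I -> R -> Prop) :
  (forall i, i \in r -> for_small (Q i)) ->
  for_small (fun e => forall i, i \in r -> Q i e).
Proof.
elim: r => [|i r IH] Qr; first by exists 1.
have [eps eps0 Qeps] := Qr i (mem_head _ _).
have [|del del0 Qdel] := IH; first by move=> j jr; apply: Qr; rewrite inE jr orbT.
exists (Num.min eps del) => [|e]; first by rewrite lt_min eps0.
rewrite le_min => /and3P[e0 e_eps e_del] j.
rewrite inE => /predU1P[->|jr]; first by apply: Qeps; rewrite e0.
by apply: Qdel => //; rewrite e0.
Qed.

Lemma for_small_affine_gt0 (a b : R) : 0 < a \/ a = 0 /\ 0 < b ->
  for_small (fun e => 0 < a + e * b).
Proof.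
move=> [a0|[-> b0]]; last by exists 1 => // e /andP[e0 _]; rewrite add0r mulr_gt0.
exists (a / (`|b| + 1)) => [|e /andP[e0 ea]]; first by rewrite divr_gt0 // ltr_wpDl.
have b1 : 0 < `|b| + 1 by rewrite ltr_wpDl.
have : e * (`|b| + 1) <= a by rewrite -ler_pdivlMr.
have : - (e * `|b|) <= e * b.
  by rewrite -mulrN ler_pM2l // lerNl -normrN ler_norm.
lra.
Qed.

End Eventually.

Section GenericPoint.
Variables (R : realType) (d : nat).

(** Otherwise [1, 2, ..., size q] would all be roots. *)
Lemma poly_positive_nonroot (q : {poly R}) : q != 0 -> exists2 t, 0 < t & ~~ root q t.
Proof.
move=> q0; apply: contrapT => noroot.
pose rs : seq R := [seq i.+1%:R | i <- iota 0 (size q)].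
have : (size rs < size q)%N.
  apply: max_poly_roots => //; last first.
    by rewrite map_inj_uniq ?iota_uniq // => i j /eqP; rewrite eqr_nat => /eqP[].
  apply/allP => _ /mapP[i _ ->]; apply: contrapT => /negP nr.
  by apply: noroot; exists i.+1%:R.
by rewrite size_map size_iota ltnn.
Qed.

(** A point of the moment curve [t |-> \sum_i t^i g_i] lies in a subspace
    missing some [g_i] for finitely many [t] only: some linear form that
    vanishes on the subspace is a nonzero polynomial in [t]. *)
Lemma moment_curve_avoids (g : seq 'rV[R]_d) (Us : seq {vspace 'rV[R]_d}) :
  (forall U, U \in Us -> exists2 x, x \in g & x \notin U) ->
  exists2 t : R, 0 < t &
    forall U, U \in Us -> \sum_(i < size g) t ^+ i *: g`_i \notin U.
Proof.
move=> gU; have polyU U : U \in Us -> exists2 q : {poly R}, q != 0 &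
    forall t, \sum_(i < size g) t ^+ i *: g`_i \in U -> root q t.
  move=> /gU[x xg xU]; pose f := (\1 - projv U)%VF.
  have fE y : f y = y - projv U y by rewrite add_lfunE opp_lfunE id_lfunE.
  have /rV0Pn[j fxj] : f x != 0.
    by apply: contra xU; rewrite fE subr_eq0 => /eqP ->; apply: memv_proj.
  exists (\poly_(i < size g) (f g`_i 0 j)) => [|t ytU].
    apply: contra fxj => /eqP q0; have xi : (index x g < size g)%N by rewrite index_mem.
    have := coef_poly (size g) (fun i => f g`_i 0 j) (index x g).
    by rewrite xi q0 coef0 nth_index // => <-.
  apply/eqP; rewrite horner_poly.
  have : f (\sum_(i < size g) t ^+ i *: g`_i) 0 j = 0.
    by rewrite fE projv_id // subrr mxE.
  rewrite linear_sum summxE => y0; rewrite -[RHS]y0.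
  by apply: eq_bigr => i _; rewrite linearZ mxE mulrC.
have {polyU} [q q0 qU] : exists2 q : {poly R}, q != 0 &
    forall t U, U \in Us -> \sum_(i < size g) t ^+ i *: g`_i \in U -> root q t.
  elim: Us polyU {gU} => [|U Us IH] polyU; first by exists 1; rewrite ?oner_eq0.
  have [q1 q10 q1U] := polyU U (mem_head _ _).
  have [|q2 q20 q2U] := IH; first by move=> W WUs; apply: polyU; rewrite inE WUs orbT.
  exists (q1 * q2) => [|t W]; first by rewrite mulf_neq0.
  rewrite inE rootM => /predU1P[->/q1U->//|WUs /(q2U _ _ WUs) ->].
  by rewrite orbT.
have [t t0 qt] := poly_positive_nonroot q0.
by exists t => // U UUs; apply: contra qt; apply: qU.
Qed.

End GenericPoint.

(** * Pure simplicial fans *)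

Section IndexedFamilies.
Variables (K : fieldType) (vT : vectType K) (T : eqType) (f : T -> vT).
Implicit Types (r : seq T) (c : T -> K).

Lemma span_mapP r x : uniq r -> x \in <<map f r>>%VS ->
  exists c, x = \sum_(v <- r) c v *: f v.
Proof.
elim: r x => [|v r IH] x /=.
  by rewrite span_nil memv0 => _ /eqP ->; exists (fun=> 0); rewrite big_nil.
move=> /andP[vr r_uniq]; rewrite span_cons => /memv_addP[_ /vlineP[k ->] [y yr ->]].
have [c ->] := IH y r_uniq yr.
exists (fun u => if u == v then k else c u); rewrite big_cons eqxx; congr (_ + _).
by apply: eq_big_seq => u ur; case: eqVneq => // uv; rewrite -uv ur in vr.
Qed.

Lemma free_map r : uniq r ->
  (forall c, \sum_(v <- r) c v *: f v = 0 -> {in r, forall v, c v = 0}) ->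
  free (map f r).
Proof.
elim: r => [|v r IH] /=; first by rewrite nil_free.
move=> /andP[vr r_uniq] rfree; rewrite free_cons.
have off_v k c : \sum_(u <- r) (if u == v then k else c u) *: f u =
    \sum_(u <- r) c u *: f u.
  by apply: eq_big_seq => u ur; case: eqVneq => // uv; rewrite -uv ur in vr.
apply/andP; split.
  apply/negP => /(span_mapP r_uniq)[c vE].
  have := rfree (fun u => if u == v then -1 else c u).
  rewrite big_cons eqxx off_v -vE scaleN1r addNr => /(_ erefl v (mem_head _ _)).
  by move/eqP; rewrite eqxx oppr_eq0 oner_eq0.
apply: IH => // c c0 u ur; have := rfree (fun x => if x == v then 0 else c x).
rewrite big_cons eqxx scale0r add0r off_v => /(_ c0 u); rewrite in_cons ur orbT.
by move=> /(_ isT); case: eqVneq => // uv; rewrite -uv ur in vr.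
Qed.

End IndexedFamilies.

Section Span.
Variables (R : realType) (s : nat).
Implicit Types (v : 'rV[int]_s) (A B : {fset 'rV[int]_s}) (c d : 'rV[int]_s -> R).

Definition cone_span A : {vspace 'rV[R]_(s + 1)} := <<[seq homog R v 1 | v <- A]>>%VS.

Lemma comb_in_span A c : comb A c \in cone_span A.
Proof.
rewrite /comb big_seq; apply: memv_suml => v vA; apply: memvZ; apply: memv_span.
exact: map_f.
Qed.

Lemma cone_in_span A z : cone_over A z -> z \in cone_span A.
Proof. by move=> [c _ ->]; apply: comb_in_span. Qed.

Lemma cone_spanP A z : z \in cone_span A -> exists c, z = comb A c.
Proof. by move=> /(span_mapP (fset_uniq A)). Qed.

Definition cone_free A :=
  forall c : 'rV[int]_s -> R, comb A c = 0 -> forall v, v \in A -> c v = 0.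

Lemma cone_free_inj A c d : cone_free A -> comb A c = comb A d -> {in A, c =1 d}.
Proof.
move=> Afree cd v vA; apply/eqP; rewrite -subr_eq0; apply/eqP.
apply: (Afree (fun v => c v - d v)) => //.
have -> : comb A (fun v => c v - d v) = comb A c - comb A d; last by rewrite cd subrr.
by rewrite -scaleN1r -combZ -combD; apply: eq_comb => u _; rewrite mulN1r.
Qed.

Lemma dim_cone_span A : cone_free A -> \dim (cone_span A) = #|` A|%fset.
Proof.
move=> Afree; suff /eqP -> : free [seq homog R v 1 | v <- A] by rewrite size_map.
exact: free_map (fset_uniq A) Afree.
Qed.

End Span.

Section Fan.
Variables (R : realType) (s : nat).
Variables (V : {fset 'rV[int]_s}) (T : {fset {fset 'rV[int]_s}}).
Implicit Types (v : 'rV[int]_s) (sigma tau : {fset 'rV[int]_s})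
  (c d : 'rV[int]_s -> R) (z : 'rV[R]_(s + 1)).

(** The simplices of [T] span a simplicial fan that subdivides the cone over
    [V], with all maximal cones generated by the same number of vectors. *)
Record pure_fan : Prop := PureFan {
  fan_free : forall sigma, sigma \in T -> cone_free R sigma;
  fan_face : forall sigma tau, sigma \in T -> (tau `<=` sigma)%fset -> tau \in T;
  fan_sub : forall sigma z, sigma \in T -> cone_over sigma z -> cone_over V z;
  fan_cover : forall z, cone_over V z ->
    exists2 sigma, sigma \in T & cone_over sigma z;
  fan_inter : forall sigma tau z, sigma \in T -> tau \in T ->
    cone_over sigma z -> cone_over tau z ->
    cone_over (sigma `&` tau)%fset z;
  fan_pure : forall sigma tau, maximal_simplex T sigma -> maximal_simplex T tau ->
    #|` sigma|%fset = #|` tau|%fset }.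

(** The induction climbs to strictly larger simplices; their cardinals are
    bounded by [N]. *)
Lemma maximal_above sigma : sigma \in T ->
  exists2 tau, maximal_simplex T tau & (sigma `<=` tau)%fset.
Proof.
pose N := (\max_(tau <- T) #|` tau|)%N.
have leN tau : tau \in T -> (#|` tau| <= N)%N.
  by move=> tauT; rewrite /N (big_fsetD1 tau) //= leq_maxl.
have [k] := ubnP (N - #|` sigma|)%N; elim: k sigma => // k IH sigma kN sT.
have [max_s|] := pselect (maximal_simplex T sigma); first by exists sigma.
move=> /not_andP[//|/existsNP[tau /not_implyP[tauT /not_implyP[st ts]]]].
have card_lt : (#|` sigma| < #|` tau|)%N.
  by apply: fproper_ltn_card; rewrite fproperEneq st andbT; apply/eqP => /esym.
have [|//|rho max_rho tr] := IH tau.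
  by have := leN _ tauT; lia.
by exists rho => //; apply: fsubset_trans tr.
Qed.

Hypothesis fan : pure_fan.

Lemma maximal_cover z : cone_over V z ->
  exists2 sigma, maximal_simplex T sigma & cone_over sigma z.
Proof.
move=> /(fan_cover fan)[sigma sT sz]; have [tau tmax st] := maximal_above sT.
by exists tau => //; apply: cone_over_mono sz.
Qed.

(** A generic point [y] of the cone avoids every proper subspace spanned by a
    simplex. The maximal cone that contains [y] must then span everything; by
    purity so do all maximal cones, and [y] has no zero coordinate in any of
    them, since their facets span proper subspaces. *)
Lemma generic_point : exists y (beta : {fset 'rV[int]_s} -> 'rV[int]_s -> R),
  cone_over V y /\ forall sigma, maximal_simplex T sigma ->
    [/\ y = comb sigma (beta sigma), {in sigma, forall v, beta sigma v != 0}
      & forall z, cone_over V z -> exists c, z = comb sigma c].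
Proof.
pose W := cone_span R V.
pose Us := [seq cone_span R tau | tau <- T & ~~ (W <= cone_span R tau)%VS].
pose g := [seq homog R v 1 | v <- V].
have gU U : U \in Us -> exists2 x, x \in g & x \notin U.
  move=> /mapP[tau]; rewrite mem_filter => /andP[Wtau _] ->.
  apply: contrapT => gU; case/negP: Wtau; apply/span_subvP => x xg.
  by apply: contrapT => /negP xU; apply: gU; exists x.
have [t t0 yU] := moment_curve_avoids gU.
set y := \sum_(i < size g) _ in yU.
have yV : cone_over V y.
  rewrite /y; elim/big_rec: _ => [|i z _]; first exact: cone_over0.
  apply: cone_overD; apply: cone_overZ; first by rewrite exprn_ge0 // ltW.
  have : g`_i \in g by apply: mem_nth.
  by move=> /mapP[v vV ->]; apply: cone_over_gen.
have Wspan sigma : sigma \in T -> y \in cone_span R sigma -> (W <= cone_span R sigma)%VS.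
  move=> sT ys; apply: contraLR ys => Ws; apply: yU.
  by apply: map_f; rewrite mem_filter Ws.
have spanW sigma : sigma \in T -> (cone_span R sigma <= W)%VS.
  move=> sT; apply/span_subvP => _ /mapP[v vs ->]; apply: cone_in_span.
  exact: (fan_sub fan sT) (cone_over_gen _ vs).
have [sigma0 max0 y0] := maximal_cover yV.
have span0 : cone_span R sigma0 = W.
  by apply/eqP; rewrite eqEsubv spanW ?(Wspan _ max0.1) ?(cone_in_span y0) ?max0.1.
have spanE sigma : maximal_simplex T sigma -> cone_span R sigma = W.
  move=> max_s; apply/eqP; rewrite eqEdim (spanW _ max_s.1) -span0.
  by rewrite (dim_cone_span (fan_free fan max_s.1)) (dim_cone_span (fan_free fan max0.1))
    (fan_pure fan max0 max_s) leqnn.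
have coord sigma z : maximal_simplex T sigma -> cone_over V z ->
    exists c, z = comb sigma c.
  by move=> /spanE spanE_s /cone_in_span zW; apply: cone_spanP; rewrite spanE_s.
have /choice[beta betaP] : forall sigma, exists b : 'rV[int]_s -> R,
    maximal_simplex T sigma -> y = comb sigma b.
  move=> sigma; have [max_s|?] := pselect (maximal_simplex T sigma); last by exists (fun=> 0).
  by have [b ->] := coord _ _ max_s yV; exists b.
exists y, beta; split=> // sigma max_s; split; [exact: betaP| |by move=> z; apply: coord].
move=> v vs; apply/eqP => bv0; pose tau := (sigma `\ v)%fset.
have tauT : tau \in T by apply: (fan_face fan max_s.1); apply: fsubD1set.
have /Wspan : y \in cone_span R tau.
  suff -> : y = comb tau (beta sigma) by apply: comb_in_span.
  by rewrite (betaP _ max_s) /comb (big_fsetD1 v) //= bv0 scale0r add0r.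
move=> /(_ tauT) /dimvS; rewrite -(spanE _ max_s).
rewrite (dim_cone_span (fan_free fan tauT)) (dim_cone_span (fan_free fan max_s.1)).
by rewrite (cardfsD1 v sigma) vs /tau add1n ltnn.
Qed.

End Fan.

(** * The half-open decomposition *)

Section HalfOpenCones.
Variables (R : realType) (s : nat).
Implicit Types (v : 'rV[int]_s) (V sigma tau : {fset 'rV[int]_s}) (c b : 'rV[int]_s -> R)
  (y z : 'rV[R]_(s + 1)).

(** Here [b] holds the coordinates of the generic point: the facet opposite to
    [v] is left out when the generic point lies strictly beyond it. *)
Definition half_open_cone b sigma : set 'rV[R]_(s + 1) :=
  [set z | exists2 c, {in sigma, forall v, if b v < 0 then 0 < c v else 0 <= c v}
                    & z = comb sigma c].

Lemma half_open_sub b sigma z : half_open_cone b sigma z -> cone_over sigma z.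
Proof. by move=> [c c0 ->]; exists c => // v /c0; case: ifP => // _ /ltW. Qed.

(** Where [c v] vanishes, [b v] is positive, so all coordinates [c v + e * b v]
    are positive for small [e]. *)
Lemma half_open_interior y b sigma z : {in sigma, forall v, b v != 0} ->
  y = comb sigma b -> half_open_cone b sigma z ->
  for_small (fun e => exists2 c, {in sigma, forall v, 0 < c v} & z + e *: y = comb sigma c).
Proof.
move=> b0 -> [c c0 ->].
have [v vs|eps eps0 epsP] :=
  @for_small_all _ _ sigma (fun v e => 0 < c v + e * b v) _.
  apply: for_small_affine_gt0; have := c0 v vs; have := b0 v vs.
  by case: ltgtP => // bv0 _; [left|rewrite le_eqVlt => /predU1P[<-|]; [right|left]].
exists eps => // e /epsP ce; exists (fun v => c v + e * b v) => //.
by rewrite combD combZ.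
Qed.

(** The condition that fails at some [v] makes [c v + e * b v] negative for
    small [e]. *)
Lemma not_half_open_exterior y b sigma z c : cone_free R sigma ->
  y = comb sigma b -> z = comb sigma c -> ~ half_open_cone b sigma z ->
  for_small (fun e => ~ cone_over sigma (z + e *: y)).
Proof.
move=> sfree -> -> not_half.
have [v vs cv] : exists2 v, v \in sigma & c v < 0 \/ c v = 0 /\ b v < 0.
  apply: contrapT => nv; apply: not_half; exists c => // v vs.
  case: ifP => bv.
    rewrite ltNge; apply/negP => cv; apply: nv; exists v => //.
    by move: cv; rewrite le_eqVlt => /predU1P[->|]; [right|left].
  by rewrite leNgt; apply/negP => cv; apply: nv; exists v => //; left.
have [|eps eps0 epsP] := @for_small_affine_gt0 _ (- c v) (- b v).
  by rewrite !oppr_gt0; case: cv => [|[-> ?]]; [left|right; rewrite oppr0].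
exists eps => // e /epsP; rewrite mulrN -opprD oppr_gt0 => ce [d d0].
rewrite -combZ -combD => /(cone_free_inj sfree)/(_ v vs) /= cd.
by move: ce; rewrite cd ltNge d0.
Qed.

Variables (V : {fset 'rV[int]_s}) (T : {fset {fset 'rV[int]_s}}).
Hypothesis fan : pure_fan R V T.
Variables (y : 'rV[R]_(s + 1)) (beta : {fset 'rV[int]_s} -> 'rV[int]_s -> R).
Hypothesis yV : cone_over V y.
Hypothesis y_generic : forall sigma, maximal_simplex T sigma ->
  [/\ y = comb sigma (beta sigma), {in sigma, forall v, beta sigma v != 0}
    & forall z, cone_over V z -> exists c, z = comb sigma c].

(** Moving a point slightly towards [y] takes it into the interior of exactly
    one maximal cone; the points for which this cone is the one over [sigma]
    form the half-open cone of [sigma]. *)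
Lemma half_open_cover z : cone_over V z ->
  exists2 sigma, maximal_simplex T sigma & half_open_cone (beta sigma) sigma z.
Proof.
move=> zV; apply: contrapT => no_half.
have [sigma sT|eps eps0 epsP] := @for_small_all R _ T
    (fun sigma e => maximal_simplex T sigma -> ~ cone_over sigma (z + e *: y)) _.
  have [max_s|?] := pselect (maximal_simplex T sigma); last by exists 1.
  have [yE _ /(_ z zV)[c zE]] := y_generic max_s.
  have [|eps eps0 epsP] := not_half_open_exterior (fan_free fan sT) yE zE.
    by move=> half; apply: no_half; exists sigma.
  by exists eps => // e /epsP.
have [|sigma max_s] := maximal_cover fan (z := z + eps *: y).
  by apply: cone_overD => //; apply: cone_overZ => //; apply: ltW.
by apply: epsP (max_s); rewrite ?eps0 ?lexx //; apply: max_s.1.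
Qed.

Lemma half_open_disjoint sigma tau z :
  maximal_simplex T sigma -> maximal_simplex T tau ->
  half_open_cone (beta sigma) sigma z -> half_open_cone (beta tau) tau z ->
  sigma = tau.
Proof.
move=> max_s max_t half_s half_t.
have [ys bs _] := y_generic max_s; have [yt bt _] := y_generic max_t.
have [e1 e10 small1] := half_open_interior bs ys half_s.
have [e2 e20 small2] := half_open_interior bt yt half_t.
pose e := Num.min e1 e2; have e0 : 0 < e by rewrite lt_min e10.
have [|c c0 cE] := small1 e; first by rewrite e0 ge_min lexx.
have [|d d0 dE] := small2 e; first by rewrite e0 ge_min lexx orbT.
have [||k _ kE] := fan_inter fan (z := z + e *: y) max_s.1 max_t.1.
- by exists c => // v /c0/ltW.
- by exists d => // v /d0/ltW.
(* The coordinates of the common point off the common face are zero; those of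
   an interior point are not. *)
apply/esym/max_s.2; first exact: max_t.1.
apply/fsubsetP => v vs; apply: contraT => vt.
have := c0 v vs; move: kE; rewrite cE (comb_widen _ (fsubsetIl sigma tau)).
move=> /(cone_free_inj (fan_free fan max_s.1))/(_ v vs) ->.
by rewrite /extension0 in_fsetI (negbTE vt) andbF ltxx.
Qed.

End HalfOpenCones.

(** * From half-open cones to boxes *)

Section Boxes.
Variables (R : realType) (s p : nat) (w : 'I_p -> {scalar 'rV[R]_s}).
Hypothesis w_int : integral_weights w.
Variables (b : 'rV[int]_s -> R) (sigma : {fset 'rV[int]_s}).
Hypothesis sigma_free : cone_free R sigma.
Implicit Types (a v : 'rV[int]_s) (S : seq 'rV[int]_s) (c : 'rV[int]_s -> R) (n : nat).

(** Between the half-open cone ([S] empty) and the half-open parallelepiped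
    ([S] all of [sigma]): only the coordinates in [S] are bounded above. *)
Definition half_open_box S n : set 'rV[int]_s :=
  [set a | exists c, [/\ {in sigma, forall v, if b v < 0 then 0 < c v else 0 <= c v},
                         {in S, forall v, if b v < 0 then c v <= 1 else c v < 1}
                       & homog R a n = comb sigma c]].

Lemma half_open_box_nil n :
  half_open_box [::] n = [set a | half_open_cone b sigma (homog R a n)].
Proof.
by apply/seteqP; split=> a [c] => [[c0 _ aE]|c0 aE]; exists c.
Qed.

Lemma half_open_box_cone S n a : half_open_box S n a -> cone_over sigma (homog R a n).
Proof. by move=> [c [c0 _ aE]]; exists c => // v /c0; case: ifP => // _ /ltW. Qed.

Lemma half_open_box_finite S n : finite_set (half_open_box S n).
Proof. exact: sub_finite_set (@half_open_box_cone S n) (cone_fiber_finite R sigma n). Qed.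

Definition coord_shift v c (t : R) u := if u == v then c u + t else c u.

Lemma comb_coord_shift v c t : v \in sigma ->
  comb sigma (coord_shift v c t) = comb sigma c + t *: homog R v 1.
Proof.
move=> vs; rewrite -(comb_delta R vs) -combZ -combD; apply: eq_comb => u _.
by rewrite /coord_shift; case: eqP => // _; rewrite ?mulr1 ?mulr0 ?addr0.
Qed.

Lemma half_open_box_shift v S n a : v \in sigma -> v \notin S ->
  half_open_box S n a -> half_open_box S n.+1 (a + v).
Proof.
move=> vs vS [c [c0 c1 cE]]; exists (coord_shift v c 1); split=> [u us|u uS|].
- have := c0 u us; rewrite /coord_shift; case: eqP => // _.
  by case: ifP => _ cu; rewrite ?ltr_wpDr ?addr_ge0.
- by have := c1 u uS; rewrite /coord_shift; case: eqP => // uv; rewrite -uv uS in vS.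
- by rewrite comb_coord_shift // -cE scale1r -homogS.
Qed.

(** Decreasing the coordinate at [v] by one leaves the set exactly when that
    coordinate satisfies the upper bound. At height zero all coordinates vanish
    and the bound holds automatically. *)
Lemma half_open_box_unshifted v S n : v \in sigma -> v \notin S ->
  unshifted v (half_open_box S) n = half_open_box (v :: S) n.
Proof.
move=> vs vS; apply/seteqP; split=> a.
  have extend c m : {in sigma, forall v, if b v < 0 then 0 < c v else 0 <= c v} ->
      {in S, forall v, if b v < 0 then c v <= 1 else c v < 1} ->
      homog R a m = comb sigma c -> (if b v < 0 then c v <= 1 else c v < 1) ->
      half_open_box (v :: S) m a.
    by move=> c0 c1 cE cv; exists c; split=> // u; rewrite inE => /predU1P[->|/c1].
  case: n => [|n] /=.
    move=> [c [c0 c1 cE]]; apply: (extend c) => //.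
    have/homog_cone0 a0 : cone_over sigma (homog R a 0).
      by rewrite cE; exists c => // u /c0; case: ifP => // _ /ltW.
    suff -> : c v = 0 by rewrite ler01 ltr01; case: ifP.
    apply: sigma_free vs; rewrite -cE a0 /homog /lattice_pt map_mx0.
    exact: at_height00.
  move=> [[c [c0 c1 cE]] not_shift]; apply: (extend c) => //.
  apply: contrapT => cv; apply: not_shift; exists (a - v); last by rewrite subrK.
  exists (coord_shift v c (-1)); split=> [u us|u uS|].
  - have := c0 u us; rewrite /coord_shift; case: eqP => // -> _.
    by case: ifP cv => _ /negP; rewrite -?ltNge -?leNgt ?subr_gt0 ?subr_ge0.
  - by have := c1 u uS; rewrite /coord_shift; case: eqP => // uv; rewrite -uv uS in vS.
  - rewrite comb_coord_shift // -cE scaleN1r; apply/eqP; rewrite -subr_eq opprK.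
    by rewrite -homogS subrK.
move=> [c [c0 c1 cE]].
have aS : half_open_box S n a.
  by exists c; split=> // u uS; apply: c1; rewrite inE uS orbT.
case: n cE aS => [|n] //= cE aS; split=> // -[a' [c' [c'0 _ c'E]] aE].
have := c'0 v vs; have := c1 v (mem_head _ _).
have -> : c v = c' v + 1.
  have := @cone_free_inj _ _ sigma c (coord_shift v c' 1) sigma_free _ v vs.
  rewrite /coord_shift eqxx; apply.
  by rewrite -/(coord_shift _ _ _) comb_coord_shift // -c'E scale1r -homogS aE -cE.
by case: ifP => _; [rewrite gerDr leNgt => /negbTE ->|rewrite gtrDr ltNge => /negbTE ->].
Qed.

Local Notation wt := (weight_vector w).

Lemma series_mul_half_open S : uniq S -> {subset S <= sigma} ->
  series_mul (poles (map wt S)) (weight_gf w (half_open_box [::])) =1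
  weight_gf w (half_open_box S).
Proof.
rewrite /poles; elim: S => [_ _ n|v S IH]; first by rewrite big_nil series_mul1.
move=> /= /andP[vS S_uniq] Ss n; rewrite big_cons series_mulA.
have vs : v \in sigma by apply: Ss; rewrite inE eqxx.
have sub : {subset S <= sigma} by move=> u uS; apply: Ss; rewrite inE uS orbT.
rewrite (eq_series_mul _ (IH S_uniq sub)) weight_gf_unshifted //.
- by apply: eq_weight_gf; apply: half_open_box_unshifted.
- by move=> m; apply: half_open_box_finite.
- by move=> m a; apply: half_open_box_shift.
Qed.

(** The height is the sum of the coordinates, each at most [1]. *)
Lemma half_open_box_high n : (#|` sigma|%fset < n)%N -> half_open_box sigma n = set0.
Proof.
move=> ns; apply/seteqP; split=> // a [c [_ c1]].
rewrite combE => /at_height_inj[_ nE]; move: ns; rewrite ltnNge => /negP[].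
rewrite -(ler_nat R) nE.
have -> : #|` sigma|%fset%:R = \sum_(v <- sigma) 1 :> R.
  by rewrite big_const_seq count_predT iter_addr_0.
rewrite big_seq [leRHS]big_seq; apply: ler_sum => v /c1.
by case: ifP => // _ /ltW.
Qed.

End Boxes.

(** * Compatible triangulations *)

Section TriangulatedPolytopes.
Variables (R : realType) (s : nat) (V : {fset 'rV[int]_s}).
Variable T : {fset {fset 'rV[int]_s}}.
Implicit Types (v : 'rV[int]_s) (sigma tau : {fset 'rV[int]_s}).

Local Notation P := (lattice_hull V : set 'rV[R]_s).

(** A nonzero point of a cone has positive height and can be scaled to height
    one, where cones are hulls; the origin needs the empty simplex. *)
Lemma triangulation_fan : triangulation P T -> fset0 \in T ->
  (forall sigma tau, maximal_simplex T sigma -> maximal_simplex T tau ->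
     #|` sigma|%fset = #|` tau|%fset) ->
  pure_fan R V T.
Proof.
move=> [indep face PE inter] T0 pure.
have scale A (z : 'rV[R]_(s + 1)) : cone_over A z ->
    z = 0 \/ exists x t, [/\ 0 < t, z = at_height x t & lattice_hull A (t^-1 *: x)].
  have [x [t ->]] := at_height_surj z => zA.
  have [t_ge0 t0] := cone_over_height zA.
  have [t0'|tn0] := eqVneq t 0; first by left; rewrite t0' t0 // at_height00.
  have t_gt0 : 0 < t by rewrite lt0r tn0.
  by right; exists x, t; split=> //; apply/cone_over_hull.
split=> //.
- move=> sigma sT c; rewrite combE -at_height00 => /at_height_inj[c1 c0] v.
  exact: (indep _ sT).
- move=> sigma z sT [c c0 ->]; rewrite /comb big_seq.
  elim/big_ind: _ => [|x y|v vs]; first exact: cone_over0.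
    exact: cone_overD.
  apply: cone_overZ; first exact: c0.
  apply/lattice_hull_cone; rewrite PE; exists sigma => //.
  exact: lattice_hull_vertex.
- move=> z /scale[->|[x [t [t0 -> xt]]]]; first by exists fset0 => //; apply: cone_over0.
  by move: xt; rewrite PE => -[sigma sT xt]; exists sigma => //; apply/cone_over_hull.
- move=> sigma tau z sT tT /scale[-> _|[x [t [t0 -> xs]]]]; first exact: cone_over0.
  move=> /(cone_over_hull _ _ t0) xt; apply/cone_over_hull => //.
  by rewrite -inter.
Qed.

Variables (p : nat) (w : 'I_p -> {scalar 'rV[R]_s}).
Hypothesis w_int : integral_weights w.

Local Notation wt := (weight_vector w).

Lemma weighted_ehrhart_gf n :
  weighted_ehrhart w P n = weight_gf w (fun m => [set a | cone_over V (homog R a m)]) n.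
Proof. by rewrite /weighted_ehrhart cone_lattice_hull. Qed.

Lemma weighted_ehrhart0 : weighted_ehrhart w P 0 = 1.
Proof.
rewrite weighted_ehrhart_gf /weight_gf (_ : [set _ | _] = [set 0]).
  rewrite fsbig_set1 -lmonom0; congr lmonom; apply/rowP => i; rewrite !mxE.
  by rewrite /lattice_pt map_mx0 linear0 floor0.
by apply/seteqP; split=> a /=; rewrite homog_cone0.
Qed.

(** All half-open cones share the denominator, and the sum of their box
    generating functions is a numerator without negative coefficients. *)
Lemma compatible_fraction sigma : pure_fan R V T -> compatible w T ->
  maximal_simplex T sigma ->
  exists2 N, pnonneg N & series_eq_frac (weighted_ehrhart w P) N (poles (map wt sigma)).
Proof.
move=> fan comp max_s; have [y [beta [yV y_gen]]] := generic_point fan.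
pose Mx := [seq tau <- T | `[< maximal_simplex T tau >]].
have MxP tau : tau \in Mx -> maximal_simplex T tau.
  by rewrite mem_filter => /andP[/asboolP].
pose box S tau := half_open_box (beta tau) tau S.
pose F n : laurent p := \sum_(tau <- Mx) weight_gf w (box [::] tau) n.
have FE : weighted_ehrhart w P =1 F.
  move=> n; rewrite weighted_ehrhart_gf /F /weight_gf.
  apply: fsbig_partition => [||tau /MxP tmax|a|tau rho a /MxP tmax /MxP rmax].
  - by rewrite filter_uniq // fset_uniq.
  - exact: cone_fiber_finite.
  - by rewrite /box half_open_box_nil => a /half_open_sub/(fan_sub fan tmax.1).
  - move=> /(half_open_cover fan yV y_gen)[tau tmax ta]; exists tau.
      by rewrite mem_filter; apply/andP; split; [apply/asboolP|apply: tmax.1].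
    by rewrite /box half_open_box_nil.
  - rewrite /box !half_open_box_nil => ta ra.
    exact: (half_open_disjoint fan y_gen tmax rmax ta ra).
pose G n : laurent p := \sum_(tau <- Mx) weight_gf w (box tau tau) n.
exists (\poly_(n < #|` sigma|%fset.+1) G n) => [n|n].
  rewrite coef_poly; case: ifP => _; last by move=> b; rewrite lcoef0.
  by apply: lnonneg_sum => tau _; apply: weight_gf_nonneg.
have -> : (\poly_(n < #|` sigma|%fset.+1) G n)`_n = G n.
  rewrite coef_poly; case: ltnP => // ns; rewrite /G big_seq big1 // => tau /MxP tmax.
  by rewrite /weight_gf /box half_open_box_high ?fsbig_set0 // (fan_pure fan tmax max_s).
rewrite -/(series_mul _ _ n) (eq_series_mul _ FE) series_mul_sum /G.
apply: eq_big_seq => tau /MxP tmax.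
have -> : poles (map wt sigma) = poles (map wt tau) by apply: perm_big; apply: comp.
by apply: series_mul_half_open => //; [exact: (fan_free fan tmax.1)|exact: fset_uniq].
Qed.

End TriangulatedPolytopes.

(** A triangulation of the empty polytope may lack even the empty simplex, and
    then its cones do not cover the origin; the empty simplex is added. *)
Lemma compatible_triangulation_fan (R : realType) s p (V : {fset 'rV[int]_s})
    (w : 'I_p -> {scalar 'rV[R]_s}) T0 :
  triangulation (lattice_hull V : set 'rV[R]_s) T0 -> compatible w T0 ->
  exists2 T, pure_fan R V T & compatible w T.
Proof.
move=> tri0 comp0.
suff [T [triT compT T_0]] :
    exists T, [/\ triangulation (lattice_hull V : set 'rV[R]_s) T, compatible w T
                & fset0 \in T].
  exists T => //; apply: triangulation_fan => // sigma tau max_s max_t.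
  by have /perm_size := compT _ _ max_s max_t; rewrite !size_map.
have [indep face PE inter] := tri0.
have [T0E|[sigma sT]] := fset_0Vmem T0; last first.
  by exists T0; split=> //; apply: face sT _; rewrite fsub0set.
exists [fset fset0]%fset; split; last by rewrite inE.
  split=> [sigma|sigma tau||sigma tau].
  - by rewrite inE => /eqP -> c _ _ v; rewrite in_fset0.
  - by rewrite !inE => /eqP -> ; rewrite fsubset0.
  - rewrite PE T0E; apply/seteqP; split=> x [sigma] /=; first by rewrite inE.
    rewrite inE => /eqP -> /lattice_hullP[c [_]]; rewrite big_nil => /eqP.
    by rewrite eq_sym oner_eq0.
  - by rewrite !inE => /eqP -> /eqP ->; rewrite setIid fsetIid.
by move=> sigma tau [] + _ [] + _; rewrite !inE => /eqP -> /eqP ->.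
Qed.

Lemma compatible_numerator_positive (R : realType) s p (P : set 'rV[R]_s)
    (w : 'I_p -> {scalar 'rV[R]_s}) :
  lattice_polytope P -> integral_weights w ->
  (exists2 T, triangulation P T & compatible w T) ->
  numerator_positive (weighted_ehrhart w P).
Proof.
move=> [V ->] w_int [T0 /compatible_triangulation_fan/[apply]] [T fan compT].
have [sigma max_s _] := maximal_cover fan (cone_over0 R V).
have [N N0 FN] := compatible_fraction w_int fan compT max_s.
exact: positive_fraction_numerator N0 (weighted_ehrhart0 V w) FN.
Qed.

(** * A square pyramid *)

Section FirstDifference.
Variable K : comNzRingType.

Definition first_difference (a : K) (f : nat -> K) n : K :=
  if n is m.+1 then f n - a * f m else f 0%N.

(** Term by term, with [u] in place of [q], this is the identity
    [(1 - u^2 x) (1 - x) G(x) = 1 - u^2 x^2 = (1 - u x) (1 + u x)] for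
    [G(x) = 1 / (1 - u^2 x) + 1 / (1 - x) - 1]. *)
Lemma corner_differences (u : K) :
  first_difference (u ^+ 2) (first_difference 1
    (fun n => if n is m.+1 then u ^+ (2 * n) + 1 else 1)) =1
  first_difference u (fun n => if n is m.+1 then if m is 0 then u else 0 else 1).
Proof.
case=> [|[|[|n]]] /=; [by []|ring|ring|].
by rewrite !mulnS !exprD; ring.
Qed.

End FirstDifference.

Section SquarePyramid.
Variable R : realType.

Definition ix : 'I_3 := @Ordinal 3 0 isT.
Definition iy : 'I_3 := @Ordinal 3 1 isT.
Definition iz : 'I_3 := @Ordinal 3 2 isT.

Definition pt (x y z : int) : 'rV[int]_3 := \row_i [:: x; y; z]`_i.

Definition apex : 'rV[int]_3 := pt 0 0 1.

Definition pyramid : {fset 'rV[int]_3} :=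
  [fset pt 0 0 0; pt 1 0 0; pt 0 1 0; pt 1 1 0; apex]%fset.

Lemma ptE x y z : (pt x y z 0 ix = x) * (pt x y z 0 iy = y) * (pt x y z 0 iz = z).
Proof. by rewrite !mxE. Qed.

Lemma row3P (K : Type) (a b : 'rV[K]_3) :
  a 0 ix = b 0 ix -> a 0 iy = b 0 iy -> a 0 iz = b 0 iz -> a = b.
Proof.
move=> abx aby abz; apply/rowP => -[[|[|[|//]]] lt_i3].
- by have -> : Ordinal lt_i3 = ix by apply: val_inj.
- by have -> : Ordinal lt_i3 = iy by apply: val_inj.
- by have -> : Ordinal lt_i3 = iz by apply: val_inj.
Qed.

(** The facet inequalities of the cone over the pyramid. *)
Definition pyramid_ineqs (a : 'rV[int]_3) (n : nat) : Prop :=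
  [/\ 0 <= a 0 ix, 0 <= a 0 iy, 0 <= a 0 iz,
      a 0 ix + a 0 iz <= n%:Z & a 0 iy + a 0 iz <= n%:Z].

Lemma pyramid_vertex_ineqs v : v \in pyramid -> pyramid_ineqs v 1.
Proof.
by rewrite !inE => /orP[/orP[/orP[/orP[]|]|]|] /eqP ->; rewrite /pyramid_ineqs !ptE.
Qed.

Lemma pyramid_coneP a n : cone_over pyramid (homog R a n) <-> pyramid_ineqs a n.
Proof.
split=> [[c c0]|[x0 y0 z0 xz yz]].
  rewrite combE => /at_height_inj[aE nE].
  have form (f : 'rV[R]_3 -> R -> R) :
      (forall r : seq 'rV[int]_3,
         f (\sum_(v <- r) c v *: lattice_pt R v) (\sum_(v <- r) c v) =
         \sum_(v <- r) c v * f (lattice_pt R v) 1) ->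
      (forall v, pyramid_ineqs v 1 -> 0 <= f (lattice_pt R v) 1) ->
      0 <= f (lattice_pt R a) n%:R.
    move=> flin fpos; rewrite aE nE flin big_seq sumr_ge0 // => v vV.
    by rewrite mulr_ge0 ?c0 //; apply/fpos/pyramid_vertex_ineqs.
  have coord i (r : seq 'rV[int]_3) : (\sum_(v <- r) c v *: lattice_pt R v) 0 i =
      \sum_(v <- r) c v * lattice_pt R v 0 i.
    by rewrite summxE; apply: eq_bigr => v _; rewrite mxE.
  have mxlat v i : lattice_pt R v 0 i = (v 0 i)%:~R by rewrite mxE.
  split.
  - have := form (fun u _ => u 0 ix) (coord ix); rewrite mxlat ler0z; apply.
    by move=> v []; rewrite mxlat ler0z.
  - have := form (fun u _ => u 0 iy) (coord iy); rewrite mxlat ler0z; apply.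
    by move=> v [_]; rewrite mxlat ler0z.
  - have := form (fun u _ => u 0 iz) (coord iz); rewrite mxlat ler0z; apply.
    by move=> v [_ _]; rewrite mxlat ler0z.
  - have := form (fun u t => t - u 0 ix - u 0 iz).
    rewrite !mxlat -addrA -opprD subr_ge0 -rmorphD /= pmulrn ler_int; apply.
      move=> r; rewrite !coord -!sumrB; apply: eq_bigr => v _; ring.
    by move=> v [_ _ _ + _]; rewrite !mxlat -addrA -opprD subr_ge0 -rmorphD -(ler_int R).
  - have := form (fun u t => t - u 0 iy - u 0 iz).
    rewrite !mxlat -addrA -opprD subr_ge0 -rmorphD /= pmulrn ler_int; apply.
      move=> r; rewrite !coord -!sumrB; apply: eq_bigr => v _; ring.
    by move=> v [_ _ _ _]; rewrite !mxlat -addrA -opprD subr_ge0 -rmorphD -(ler_int R).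
have gen (k : int) v : 0 <= k -> v \in pyramid ->
    cone_over pyramid (k%:~R *: homog R v 1).
  by move=> k0 vV; apply: cone_overZ; [rewrite ler0z|apply: cone_over_gen].
have inV v : v \in [:: pt 0 0 0; pt 1 0 0; pt 0 1 0; pt 1 1 0; apex] -> v \in pyramid.
  by rewrite !inE -!orbA.
(* The diagonal [x = y] cuts the pyramid into two simplices. *)
have [xy|yx] := leP (a 0 ix) (a 0 iy).
  have -> : homog R a n = (a 0 ix)%:~R *: homog R (pt 1 1 0) 1 +
      (a 0 iy - a 0 ix)%:~R *: homog R (pt 0 1 0) 1 + (a 0 iz)%:~R *: homog R apex 1 +
      (n%:Z - a 0 iy - a 0 iz)%:~R *: homog R (pt 0 0 0) 1.
    rewrite /homog !at_heightZ !at_heightD; congr at_height; last first.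
      by rewrite !rmorphB /= -pmulrn; ring.
    by apply: row3P; rewrite !mxE /= !rmorphB /=; ring.
  by do 3?[apply: cone_overD]; apply: gen; rewrite ?inV ?inE ?eqxx ?orbT //; lia.
have -> : homog R a n = (a 0 iy)%:~R *: homog R (pt 1 1 0) 1 +
    (a 0 ix - a 0 iy)%:~R *: homog R (pt 1 0 0) 1 + (a 0 iz)%:~R *: homog R apex 1 +
    (n%:Z - a 0 ix - a 0 iz)%:~R *: homog R (pt 0 0 0) 1.
  rewrite /homog !at_heightZ !at_heightD; congr at_height; last first.
    by rewrite !rmorphB /= -pmulrn; ring.
  by apply: row3P; rewrite !mxE /= !rmorphB /=; ring.
by do 3?[apply: cone_overD]; apply: gen; rewrite ?inV ?inE ?eqxx ?orbT //; lia.
Qed.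

Definition pyramid_form (x : 'rV[R]_3) : R := 2 * x 0 ix + x 0 iz.

Lemma pyramid_form_linear : scalar pyramid_form.
Proof. by move=> t x y; rewrite /pyramid_form !mxE; ring. Qed.

HB.instance Definition _ :=
  GRing.isLinear.Build R 'rV[R]_3 R *%R pyramid_form pyramid_form_linear.

Definition pyramid_weight (i : 'I_1) : {scalar 'rV[R]_3} := pyramid_form.

Local Notation wt := (weight_vector pyramid_weight).

Lemma pyramid_weightE i a :
  pyramid_weight i (lattice_pt R a) = (2 * a 0 ix + a 0 iz)%:~R.
Proof. by rewrite /= /pyramid_form !mxE rmorphD rmorphM. Qed.

Lemma pyramid_weight_int : integral_weights pyramid_weight.
Proof. by move=> i a; rewrite pyramid_weightE intr_int. Qed.

Lemma pyramid_wt a : wt a = const_mx (2 * a 0 ix + a 0 iz).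
Proof. by apply/rowP => i; rewrite !mxE pyramid_weightE intrKfloor. Qed.

Definition qmon (k : int) : laurent 1 := lmonom (const_mx k).

Lemma qmon0 : qmon 0 = 1.
Proof. by rewrite -lmonom0; congr lmonom; apply/rowP => i; rewrite !mxE. Qed.

(** Removing the translates by the apex, by the origin and by [(1, 1, 0)] takes
    the lattice points of the cone over the pyramid to those of the cone over
    its base, then to the two far edges of the dilated base, and finally to two
    of its corners. *)
Definition pyramid_pts n : set 'rV[int]_3 := [set a | pyramid_ineqs a n].

Definition base_pts (n : nat) : set 'rV[int]_3 :=
  [set a | [/\ 0 <= a 0 ix <= n%:Z, 0 <= a 0 iy <= n%:Z & a 0 iz = 0]].

Definition hook_pts (n : nat) : set 'rV[int]_3 :=
  [set a | base_pts n a /\ (a 0 ix = n%:Z \/ a 0 iy = n%:Z)].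

Definition corner_pts (n : nat) : set 'rV[int]_3 :=
  [set pt n%:Z 0 0; pt 0 n%:Z 0].

Lemma unshiftedP v (A : nat -> set 'rV[int]_3) n a : unshifted v A n a <->
  (if n is m.+1 then A n a /\ ~ A m (a - v) else A 0%N a).
Proof.
case: n => //= n; split=> -[Aa notA]; split=> //.
  by move=> Aav; apply: notA; exists (a - v); rewrite ?subrK.
by move=> [u Au ua]; apply: notA; rewrite -ua addrK.
Qed.

Lemma unshifted_pyramid n : unshifted apex pyramid_pts n = base_pts n.
Proof.
apply/seteqP; rewrite /pyramid_pts /base_pts /pyramid_ineqs.
split=> a; rewrite unshiftedP; case: n => [|n] /=; rewrite ?mxE /=.
- by move=> [*]; split; lia.
- move=> [[x0 y0 z0 xz yz] not_shift]; suff az : a 0 iz = 0 by split; lia.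
  apply: contrapT => az; apply: not_shift; split; lia.
- by move=> [*]; split; lia.
- by move=> [*]; split; [split; lia|move=> [*]; lia].
Qed.

Lemma unshifted_base n : unshifted (pt 0 0 0) base_pts n = hook_pts n.
Proof.
apply/seteqP; rewrite /hook_pts /base_pts.
split=> a; rewrite unshiftedP; case: n => [|n] /=; rewrite ?mxE /=.
- by move=> [*]; split; [split|left]; lia.
- move=> [[x0 y0 z0] not_shift]; split=> //; apply: contrapT => xy.
  by apply: not_shift; split; lia.
- by case.
- by move=> [[x0 y0 z0] xy]; split; [split; lia|move=> [*]; lia].
Qed.

Lemma unshifted_hook n : unshifted (pt 1 1 0) hook_pts n = corner_pts n.
Proof.
apply/seteqP; rewrite /hook_pts /base_pts /corner_pts.
split=> a; rewrite unshiftedP; case: n => [|n] /=; rewrite ?mxE /=.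
- by move=> [[x0 y0 z0] _]; left; apply: row3P; rewrite !ptE; lia.
- move=> [[[x0 y0 z0] xy] not_shift].
  have [ax|ax] := eqVneq (a 0 ix) 0.
    by right; apply: row3P; rewrite !ptE //; lia.
  left; apply: row3P; rewrite !ptE //.
    apply: contrapT => ?; apply: not_shift; split; [split; lia|lia].
  apply: contrapT => ?; apply: not_shift; split; [split; lia|lia].
- by move=> [->|->]; rewrite !ptE; split=> //; left.
- move=> [->|->]; rewrite !ptE; (split; first (split; [split; lia|lia])).
  + by move=> [[x0 y0 z0] _]; lia.
  + by move=> [[x0 y0 z0] _]; lia.
Qed.

Lemma pyramid_pts_finite n : finite_set (pyramid_pts n).
Proof. by apply: sub_finite_set (cone_fiber_finite R pyramid n) => a /pyramid_coneP. Qed.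

Lemma base_pts_finite n : finite_set (base_pts n).
Proof.
apply: sub_finite_set (pyramid_pts_finite n) => a [/andP[? ?] /andP[? ?] az].
by split; rewrite ?az ?addr0.
Qed.

Lemma hook_pts_finite n : finite_set (hook_pts n).
Proof. by apply: sub_finite_set (base_pts_finite n) => a []. Qed.

Local Notation F := (weighted_ehrhart pyramid_weight (lattice_hull pyramid)).

Lemma weight_gf_corner n :
  weight_gf pyramid_weight corner_pts n = if n is m.+1 then qmon (2 * n%:Z) + 1 else 1.
Proof.
have mon x y z : lmonom (weight_vector pyramid_weight (pt x y z)) = qmon (2 * x + z).
  by rewrite pyramid_wt !ptE.
rewrite /weight_gf /corner_pts; case: n => [|n].
  by rewrite setUid fsbig_set1 mon mulr0 addr0 qmon0.
rewrite fsbigU0 ?fsbig_set1 ?mon //=; last first.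
  by move=> a [-> /(congr1 (fun u : 'rV_3 => u 0 ix))]; rewrite !ptE.
by rewrite !addr0 mulr0 qmon0.
Qed.

Definition pyramid_numerator : {poly laurent 1} := 1 + (qmon 1)%:P * 'X.

Definition pyramid_poles : seq 'rV[int]_1 :=
  [:: const_mx 2; const_mx 0; const_mx 2; const_mx 0].

Lemma pyramid_numeratorE n :
  pyramid_numerator`_n = if n is m.+1 then if m is 0 then qmon 1 else 0 else 1.
Proof.
rewrite /pyramid_numerator coefD coef1 coefMX coefC.
by case: n => [|[|n]]; rewrite /= ?addr0 ?add0r.
Qed.

Lemma corner_series :
  series_mul (pole (const_mx 2)) (series_mul (pole (const_mx 0))
    (weight_gf pyramid_weight corner_pts)) =1
  series_mul (pole (const_mx 1)) (fun n => pyramid_numerator`_n).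
Proof.
have qE m : qmon m%:Z = qmon 1 ^+ m.
  by rewrite /qmon lmonomX; congr lmonom; apply/rowP => i; rewrite mulmxnE !mxE; lia.
have gfE : weight_gf pyramid_weight corner_pts =1
    (fun n => if n is m.+1 then qmon 1 ^+ (2 * n) + 1 else 1).
  by case=> [|m]; rewrite weight_gf_corner // -qE.
have poleE b a (A B : nat -> laurent 1) : lmonom b = a -> A =1 B ->
    series_mul (pole b) A =1 first_difference a B.
  by move=> <- AB n; rewrite series_mul_pole; case: n => [|n] /=; rewrite !AB.
have q0 : lmonom (const_mx 0) = 1 := qmon0.
move=> n; apply: etrans (poleE _ _ _ _ (qE 2%N) (poleE _ _ _ _ q0 gfE) n) _.
apply: esym; apply: etrans (poleE _ _ _ _ erefl pyramid_numeratorE n) _.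
exact: esym (corner_differences (qmon 1) n).
Qed.

(** Both sides are multiplied by [1 - q x]: on the left it acts as the factor of
    the apex, on the right it turns the numerator into [1 - q^2 x^2]. *)
Lemma pyramid_fraction : series_eq_frac F pyramid_numerator (poles pyramid_poles).
Proof.
pose pl k : {poly laurent 1} := pole (const_mx k).
have plE (v : 'rV[int]_3) : pl (2 * v 0 ix + v 0 iz) = pole (weight_vector pyramid_weight v).
  by rewrite pyramid_wt.
have step (v : 'rV[int]_3) (A B : nat -> set 'rV[int]_3) G : G =1 weight_gf pyramid_weight A ->
    (forall n, finite_set (A n)) -> (forall n a, A n a -> A n.+1 (a + v)) ->
    (forall n, unshifted v A n = B n) ->
    series_mul (pl (2 * v 0 ix + v 0 iz)) G =1 weight_gf pyramid_weight B.
  move=> GA Afin Ashift AB n; rewrite plE (eq_series_mul _ GA).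
  rewrite weight_gf_unshifted //; [exact: eq_weight_gf|exact: pyramid_weight_int].
have F0 : F =1 weight_gf pyramid_weight pyramid_pts.
  move=> n; rewrite weighted_ehrhart_gf; apply: eq_weight_gf.
  by apply/seteqP; split=> a /pyramid_coneP.
have F1 : series_mul (pl 1) F =1 weight_gf pyramid_weight base_pts.
  have := step apex _ _ _ F0 pyramid_pts_finite _ unshifted_pyramid.
  rewrite !ptE; apply=> n a [x0 y0 z0 xz yz].
  by split; rewrite !mxE /=; lia.
have F2 : series_mul (pl 0) (series_mul (pl 1) F) =1 weight_gf pyramid_weight hook_pts.
  have := step (pt 0 0 0) _ _ _ F1 base_pts_finite _ unshifted_base.
  rewrite !ptE; apply=> n a [x0 y0 z0].
  by split; rewrite !mxE /=; lia.
have F3 : series_mul (pl 2) (series_mul (pl 0) (series_mul (pl 1) F)) =1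
    weight_gf pyramid_weight corner_pts.
  have := step (pt 1 1 0) _ _ _ F2 hook_pts_finite _ unshifted_hook.
  rewrite !ptE; apply=> n a [[x0 y0 z0] xy].
  by split; [split|]; rewrite !mxE /=; lia.
suff : series_mul (poles pyramid_poles) F =1 (fun n => pyramid_numerator`_n) by [].
apply: (@series_mul_pole_inj 1 (const_mx 1)) => n; rewrite -series_mulA.
rewrite [_ * poles _]mulrC series_mulA series_mul_poles /=.
apply: etrans (corner_series n); rewrite -!/(pl _).
by apply: eq_series_mul; apply: eq_series_mul.
Qed.

Lemma pyramid_numerator_nonneg : pnonneg pyramid_numerator.
Proof.
move=> n; rewrite pyramid_numeratorE -lmonom0; case: n => [|[|n]].
- exact: lnonneg_mon.
- exact: lnonneg_mon.
- by move=> b; rewrite lcoef0.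
Qed.

Lemma pyramid_apex_or_base (v : 'rV[int]_3) : pyramid_ineqs v 1 ->
  v 0 iz = 0 \/ v = apex.
Proof.
move=> [x0 y0 z0 xz yz]; have [vz|vz] := eqVneq (v 0 iz) 0; [by left|right].
by apply: row3P; rewrite !ptE; lia.
Qed.

(** The apex is the only lattice point of the pyramid off its base, so without
    it the cone over [sigma] stays in the plane of the base. *)
Lemma apex_vertex sigma : (forall v, v \in sigma -> cone_over pyramid (homog R v 1)) ->
  cone_over sigma (homog R apex 1) -> apex \in sigma.
Proof.
move=> sub [c c0]; rewrite combE => /at_height_inj[apexE _].
apply: contraT => apex_s; have /eqP : (1 : R) = 0; last by rewrite oner_eq0.
have -> : (1 : R) = lattice_pt R apex 0 iz by rewrite mxE ptE.
rewrite apexE summxE big_seq big1 // => v vs.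
have /sub/pyramid_coneP/pyramid_apex_or_base[vz|vE] := vs.
  by rewrite !mxE vz mulr0.
by rewrite vE (negbTE apex_s) in vs.
Qed.

Lemma pyramid_not_compatible :
  ~ exists2 T, triangulation (lattice_hull pyramid : set 'rV[R]_3) T
             & compatible pyramid_weight T.
Proof.
move=> [T0 triT0 compT0].
have [T fan compT] := compatible_triangulation_fan triT0 compT0.
have apexP : cone_over pyramid (homog R apex 1).
  by apply: cone_over_gen; rewrite !inE eqxx orbT.
have [sigma max_s apex_cone] := maximal_cover fan apexP.
have apex_s : apex \in sigma.
  apply: apex_vertex apex_cone => v vs.
  exact: (fan_sub fan max_s.1) (cone_over_gen _ vs).
have [N N0 FN] := compatible_fraction pyramid_weight_int fan compT max_s.
have F0 := weighted_ehrhart0 pyramid pyramid_weight.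
have form := positive_rational_form N0 F0 FN.
have [_ polesE] := rational_form_unique pyramid_numerator_nonneg F0 pyramid_fraction form.
(* The weight of the apex gives a root of one denominator only. *)
have := root_poles [seq weight_vector pyramid_weight v | v <- sigma] (const_mx 1).
rewrite polesE root_poles.
have -> : const_mx 1 \in [seq weight_vector pyramid_weight v | v <- sigma].
  have <- : weight_vector pyramid_weight apex = const_mx 1 by rewrite pyramid_wt !ptE.
  exact: map_f.
have ne k : k != 1 -> (const_mx 1 == const_mx k :> 'rV[int]_1) = false.
  by move=> k1; apply/eqP => /rowP/(_ 0); rewrite !mxE => /esym/eqP; rewrite (negbTE k1).
by rewrite /pyramid_poles !inE !ne.
Qed.

End SquarePyramid.

Theorem theorem2p4 (R : realType) :
  (forall (s p : nat) (P : set 'rV[R]_s) (w : 'I_p -> {scalar 'rV[R]_s}),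
     lattice_polytope P -> integral_weights w ->
     (exists2 T, triangulation P T & compatible w T) ->
     numerator_positive (weighted_ehrhart w P))
  /\
  (exists (s p : nat) (P : set 'rV[R]_s) (w : 'I_p -> {scalar 'rV[R]_s}),
     [/\ lattice_polytope P, integral_weights w,
         numerator_positive (weighted_ehrhart w P)
       & ~ exists2 T, triangulation P T & compatible w T]).
Proof.
split=> [s p P w|]; first exact: compatible_numerator_positive.
exists 3, 1%N, (lattice_hull pyramid), (pyramid_weight R); split.
- by exists pyramid.
- exact: pyramid_weight_int.
- exact: positive_fraction_numerator pyramid_numerator_nonneg
    (weighted_ehrhart0 pyramid (pyramid_weight R)) (pyramid_fraction R).
- exact: pyramid_not_compatible.
Qed.
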